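(* Let $\sigma_{1},\dots,\sigma_{n},\omega$ be weights on $\mathbb{R}^{d}$, let $\Phi_{1},\dots,\Phi_{n} \in \widetilde{\mathcal{U}}\cap \nabla_{2}$ and $\Psi \in \widetilde{\mathcal{U}}$. Assume that $\Phi:\mathbb{R}_{+}\to\mathbb{R}_{+}$ is a bijection such that $\Phi^{-1}=\Phi_{1}^{-1}\times\cdots\times \Phi_{n}^{-1}$ (pointwise product) and $t\mapsto \frac{\Psi(t)}{\Phi(t)}$ is increasing on $\mathbb{R}_{+}^{*}$. Put $\nu_{\vec{\sigma}}:= \frac{1}{\Phi\left(\prod_{i=1}^{n}\Phi_{i}^{-1}\left(\frac{1}{\sigma_{i}}\right)\right)}$ and $$[\vec{\sigma},\omega]_{M_{\vec{\Phi},\Psi}}:=\sup_{Q\in \mathcal{Q}}\omega(Q)\,\Psi \circ \Phi^{-1}\left( \frac{1}{\nu_{\vec{\sigma}}(Q)}\right).$$ If $\sigma_{i}$ is doubling for every $1 \leq i \leq n$ and $[\vec{\sigma},\omega]_{M_{\vec{\Phi},\Psi}}<\infty$, then there exists a constant $C=C_{n,\sigma_{1},\dots,\sigma_{n},\Psi,\Phi_{1},\dots,\Phi_{n}}>0$ such that for any $(f_{1},\dots,f_{n}) \in L^{\Phi_{1}}(\sigma_{1})\times\cdots\times L^{\Phi_{n}}(\sigma_{n})$, $$\|\mathcal{M}_{\vec{\sigma}}(f_{1},\dots,f_{n}) \|_{L_{\omega}^{\Psi}}^{lux} \leq C\, \Psi^{-1}\left([\vec{\sigma},\omega]_{M_{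\vec{\Phi},\Psi}}\right)\prod_{i=1}^{n}\|f_{i}\|_{L_{\sigma_{i}}^{\Phi_{i}}}^{lux}.$$
   Context: $\mathbb{R}_+=[0,\infty)$, $\mathbb{R}_+^*=(0,\infty)$. $\mathcal{Q}$ is the set of non-degenerate cubes in $\mathbb{R}^d$ with sides parallel to the axes; $\ell(Q)$ is the sidelength of $Q$. A weight is a locally integrable, almost everywhere positive function $\sigma$ on $\mathbb{R}^d$; $\sigma(E)=\int_E\sigma(x)\,dx$ (the same notation is used for $\nu_{\vec\sigma}$). A weight $\sigma$ is doubling if there is $C>1$ such that for all $Q,Q'\in\mathcal{Q}$ with $Q\subset Q'$, $\ell(Q')\le2\ell(Q)$ implies $\sigma(Q')\le C\sigma(Q)$. The weighted multilinear maximal function, with $\vec\sigma=(\sigma_1,\dots,\sigma_n)$, is $$\mathcal{M}_{\vec{\sigma}}(f_1,\dots,f_n)(x):= \sup_{Q \in \mathcal{Q}}\prod_{i=1}^{n}\frac{\chi_{Q}(x)}{\sigma_{i}(Q)}\int_{Q}|f_{i}(y)|\sigma_{i}(y)\,dy .$$ A growth function is a function $\Phi:\mathbb{R}_+\to\mathbb{R}_+$, not identically zero, continuous, nondecreasing and onto. It is of upper-type $q>0$ if there is $C_q>0$ with $\Phi(st)\le C_q t^q\Phi(s)$ for all $s>0$, $t\ge 1$. For $q\ge1$, $\mathcal{U}^q$ is the set of growth functions of upper-type $q$ such that $t\mapsto\Phi(t)/t$ is nondecreasing on $\mathbb{R}_+^*$; $\mathcal{U}=\bigcup_{q\ge1}\mathcal{U}^q$.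 Standing convention: (up to replacing it by an equivalent function) every $\Phi\in\mathcal{U}$ is assumed convex, of class $C^1$, with $\Phi'(t)\approx\Phi(t)/t$ for $t>0$. $\Phi\in\Delta'$: there is $C>0$ with $\Phi(st)\le C\Phi(s)\Phi(t)$ for all $s,t>0$. $\Phi\in\Delta_2$: there is $K>0$ with $\Phi(2t)\le K\Phi(t)$ for all $t>0$. For a convex growth function $\Phi\in\Delta_2$, $\Phi\in\nabla_2$ means there is $C>0$ with $\int_0^t\frac{\Phi(s)}{s^2}ds\le C\frac{\Phi(t)}{t}$ for all $t>0$. For $q\ge1$, $\widetilde{\mathcal{U}}^q$ is the set of $\Phi\in\mathcal{U}^q\cap\Delta'$ for which there is $C>0$ with $\Phi(s/t)\le C\,\Phi(s)/t^q$ for all $s,t\ge1$; $\widetilde{\mathcal{U}}=\bigcup_{q\ge1}\widetilde{\mathcal{U}}^q$. For $\Phi\in\mathcal{U}$ and a weight $\sigma$, $L^\Phi(\sigma)$ is the set of (classes of) measurable $f:\mathbb{R}^d\to\mathbb{C}$ with $\|f\|_{L^\Phi_\sigma}^{lux}:=\inf\{\lambda>0:\int_{\mathbb{R}^d}\Phi(|f(x)|/\lambda)\sigma(x)dx\le1\}<\infty$. *)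

(* Defs.v *)
From HB Require Import structures.
From mathcomp Require Import all_boot all_order all_algebra.
From mathcomp Require Import complex.
From mathcomp Require Import all_classical all_reals all_analysis.

Set Implicit Arguments.
Unset Strict Implicit.
Unset Printing Implicit Defensive.
Import Order.TTheory GRing.Theory Num.Theory.
Import numFieldNormedType.Exports.

Local Open Scope classical_set_scope.
Local Open Scope ring_scope.

(* R^d is d.-tuple R with the product Borel sigma-algebra of the library. Its
   Lebesgue measure is built by recursion on d, as the image of the product
   measure under the identification of R * R^d with R^(d+1). *)

Section tuple_cons.
Context {R : realType} (d : nat).

Definition tcons (p : R * d.-tuple R) : d.+1.-tuple R :=
  [the d.+1.-tuple R of p.1 :: p.2].

Lemma measurable_tcons : measurable_fun setT tcons.
Proof. by apply: (@measurable_cons _ _ _ R fst d snd). Qed.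

Variable m : {sigma_finite_measure set (d.-tuple R) -> \bar R}.

Definition cons_measure : set (d.+1.-tuple R) -> \bar R :=
  pushforward (@lebesgue_measure R \x m)%E tcons.

Let cons_measure0 : cons_measure set0 = 0%E.
Proof. by rewrite /cons_measure /pushforward preimage_set0 measure0. Qed.

Let cons_measure_ge0 A : (0 <= cons_measure A)%E.
Proof. by rewrite /cons_measure /pushforward measure_ge0. Qed.

Let measurable_tcons_preimage (A : set (d.+1.-tuple R)) :
  measurable A -> measurable (tcons @^-1` A).
Proof. by move=> mA; rewrite -[X in measurable X]setTI; exact: measurable_tcons. Qed.

Let cons_measure_sigma_additive : semi_sigma_additive cons_measure.
Proof.
move=> F mF tF mUF; rewrite /cons_measure /pushforward preimage_bigcup.
apply: measure_semi_sigma_additive.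
- by move=> n; exact: measurable_tcons_preimage.
- apply/trivIsetP => /= i j _ _ ij; rewrite -preimage_setI.
  by move/trivIsetP : tF => /(_ _ _ _ _ ij) ->//; rewrite preimage_set0.
- by rewrite -preimage_bigcup; exact: measurable_tcons_preimage.
Qed.

HB.instance Definition _ := isMeasure.Build _ _ _ cons_measure
  cons_measure0 cons_measure_ge0 cons_measure_sigma_additive.

Lemma cons_measureX (A : set R) (B : set (d.-tuple R)) :
  measurable A -> measurable B ->
  cons_measure [set x | A (thead x) /\ B [tuple of behead x]] =
  (lebesgue_measure A * m B)%E.
Proof.
move=> mA mB; rewrite /cons_measure /pushforward -product_measure1E//.
congr product_measure1; apply/seteqP; split=> -[a t] /=; rewrite /thead tnth0.
  by case=> Aa Bt; split => //; move: Bt; congr B; apply/val_inj.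
by case=> Aa Bt; split => //; move: Bt; congr B; apply/val_inj.
Qed.

Let cons_measure_sigma_finite : sigma_finite setT cons_measure.
Proof.
have /sigma_finiteP[F [TF ndF Foo]] := sigma_finiteT (@lebesgue_measure R).
have /sigma_finiteP[G [TG ndG Goo]] := sigma_finiteT m.
exists (fun k => [set x | F k (thead x) /\ G k [tuple of behead x]]).
  apply/seteqP; split => // x _.
  have [i _ Fx] : (\bigcup_i F i) (thead x) by rewrite -TF.
  have [j _ Gx] : (\bigcup_j G j) [tuple of behead x] by rewrite -TG.
  exists (maxn i j) => //; split.
    by move: (thead x) Fx; exact/subsetPset/ndF/leq_maxl.
  by move: [tuple of behead x] Gx; exact/subsetPset/ndG/leq_maxr.
move=> k; have [mF Fk] := Foo k; have [mG Gk] := Goo k; split.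
  rewrite (_ : [set x | _] =
    (fun x : d.+1.-tuple R => thead x) @^-1` F k `&`
    (fun x : d.+1.-tuple R => [tuple of behead x]) @^-1` G k)//.
  apply: measurableI; rewrite -[X in measurable X]setTI.
    exact: measurable_tnth.
  exact: measurable_behead.
by rewrite cons_measureX// lte_mul_pinfty// ge0_fin_numE.
Qed.

HB.instance Definition _ := Measure_isSigmaFinite.Build _ _ _ cons_measure
  cons_measure_sigma_finite.

End tuple_cons.

Fixpoint lebesgue_tuple (R : realType) (d : nat) :
    {sigma_finite_measure set (d.-tuple R) -> \bar R} :=
  match d with
  | 0 => \d_([tuple] : 0.-tuple R)
  | d'.+1 => cons_measure (lebesgue_tuple R d')
  end.

Lemma lebesgue_tuple_box (R : realType) (d : nat) (A : 'I_d -> set R) :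
  (forall i, measurable (A i)) ->
  lebesgue_tuple R d [set x | forall i, A i (tnth x i)] =
  (\prod_(i < d) lebesgue_measure (A i))%E.
Proof.
elim: d A => [A _|d IHd A mA].
  rewrite big_ord0 /= diracE mem_set//= => -[].
  by case.
rewrite big_ord_recl -IHd// -cons_measureX//; last first.
  rewrite (_ : [set x | _] = \bigcap_(i in [set: 'I_d])
     ((fun x : d.-tuple R => tnth x i) @^-1` A (lift ord0 i))); last first.
    by apply/seteqP; split=> x /= Ax i; [move=> _|]; exact: Ax.
  apply: fin_bigcap_measurable => // i _.
  by rewrite -[X in measurable X]setTI; exact: measurable_tnth.
have behE (x : d.+1.-tuple R) i :
    tnth [tuple of behead x] i = tnth x (lift ord0 i).
  by rewrite !(tnth_nth 0)/= nth_behead.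
congr cons_measure; apply/seteqP; split=> x /=.
  move=> Ax; split; first exact: Ax.
  by move=> i; rewrite behE; exact: Ax.
move=> [A0 AS] i; case: (unliftP ord0 i) => [j|] ->//.
by rewrite -behE; exact: AS.
Qed.

Section weights.
Context {R : realType} {d : nat}.
Implicit Types (sigma : d.-tuple R -> R) (f : d.-tuple R -> R[i]).
Local Notation mu := (lebesgue_tuple R d).

(* The sigma-algebra of d.-tuple R is the Borel one, so a function is Lebesgue
   measurable iff it agrees almost everywhere with a measurable one. *)
Definition lebesgue_measurable (h : d.-tuple R -> R) :=
  exists2 g : d.-tuple R -> R, measurable_fun setT g & h = g %[ae mu].

Definition complex_measurable f :=
  lebesgue_measurable (fun x => complex.Re (f x)) /\
  lebesgue_measurable (fun x => complex.Im (f x)).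

(* Tuples carry no topology in the library: compactness is that of the
   corresponding row vectors. *)
Definition locally_integrable_tuple sigma :=
  forall K : set (d.-tuple R), compact [set \row_i tnth x i | x in K] ->
  (\int[mu]_(x in K) `|sigma x|%:E < +oo)%E.

Definition weight sigma :=
  [/\ lebesgue_measurable sigma, locally_integrable_tuple sigma &
      {ae mu, forall x, 0 < sigma x}].

Definition wmeas sigma (E : set (d.-tuple R)) : \bar R :=
  (\int[mu]_(x in E) (sigma x)%:E)%E.

Definition cube (a : d.-tuple R) (l : R) : set (d.-tuple R) :=
  [set x | forall i, tnth a i <= tnth x i <= tnth a i + l].

Definition cubes : set (set (d.-tuple R)) :=
  [set Q | exists a l, 0 < l /\ Q = cube a l].

Definition doubling sigma :=
  exists2 C : R, 1 < C &
    forall a l a' l', 0 < l -> 0 < l' -> cube a l `<=` cube a' l' ->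
      l' <= 2 * l -> (wmeas sigma (cube a' l') <= C%:E * wmeas sigma (cube a l))%E.

(* The averages use fine: sigma(Q) is a positive real number for a weight and
   a nondegenerate cube. *)
Definition maximal (n : nat) (sigma : 'I_n -> d.-tuple R -> R)
    (f : 'I_n -> d.-tuple R -> R[i]) (x : d.-tuple R) : \bar R :=
  ereal_sup [set (\prod_(i < n)
      ((\1_Q x / fine (wmeas (sigma i) Q))%:E *
       \int[mu]_(y in Q) (Normc.normc (f i y) * sigma i y)%:E))%E | Q in cubes].

(* Luxemburg functional of a nonnegative extended real-valued function; er_map
   extends Phi by Phi(+oo) = +oo. *)
Definition lux_norm (Phi : R -> R) sigma (g : d.-tuple R -> \bar R) : \bar R :=
  ereal_inf [set l%:E | l in [set l : R | 0 < l /\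
    (\int[mu]_x (er_map Phi ((l^-1)%:E * g x) * (sigma x)%:E) <= 1)%E]].

Definition cnorm f (x : d.-tuple R) : \bar R := (Normc.normc (f x))%:E.

Definition orlicz (Phi : R -> R) sigma : set (d.-tuple R -> R[i]) :=
  [set f | complex_measurable f /\ (lux_norm Phi sigma (cnorm f) < +oo)%E].

End weights.

Section growth_functions.
Context {R : realType}.
Implicit Types (Phi : R -> R).

(* Functions R_+ -> R_+ are functions on R whose values outside R_+ are
   irrelevant. *)
Definition Rplus : set R := `[0, +oo[.

Definition growth_function Phi :=
  [/\ (forall t, 0 <= t -> 0 <= Phi t),
      (exists2 t, 0 <= t & Phi t != 0),
      {within Rplus, continuous Phi},
      (forall s t, 0 <= s -> s <= t -> Phi s <= Phi t) &
      (forall y, 0 <= y -> exists2 t, 0 <= t & Phi t = y)].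

Definition upper_type (q : R) Phi :=
  exists2 C : R, 0 < C &
    forall s t, 0 < s -> 1 <= t -> Phi (s * t) <= C * t `^ q * Phi s.

Definition convexRplus Phi := @convex_function R R^o Rplus Phi.

(* The regularity that the paper assumes of every element of the class U. Being C^1 on ]0, +oo[ and
   convex with Phi 0 = 0 makes Phi C^1 up to 0. *)
Definition regular Phi :=
  [/\ convexRplus Phi,
      (forall t, 0 < t -> derivable Phi t 1),
      (forall t, 0 < t -> {for t, continuous (derive1 Phi)}) &
      exists c C : R, [/\ 0 < c, 0 < C & forall t, 0 < t ->
        c * (Phi t / t) <= derive1 Phi t <= C * (Phi t / t)]].

Definition classU_q (q : R) Phi :=
  [/\ growth_function Phi, upper_type q Phi,
      (forall s t, 0 < s -> s <= t -> Phi s / s <= Phi t / t) &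
      regular Phi].

Definition delta_prime Phi :=
  exists2 C : R, 0 < C &
    forall s t, 0 < s -> 0 < t -> Phi (s * t) <= C * Phi s * Phi t.

Definition delta2 Phi :=
  exists2 K : R, 0 < K & forall t, 0 < t -> Phi (2 * t) <= K * Phi t.

Definition nabla2 Phi :=
  [/\ growth_function Phi, convexRplus Phi, delta2 Phi &
      exists2 C : R, 0 < C & forall t, 0 < t ->
        (\int[lebesgue_measure]_(s in `]0%R, t[) (Phi s / s ^+ 2)%:E
           <= (C * (Phi t / t))%:E)%E].

Definition classUtilde_q (q : R) Phi :=
  [/\ classU_q q Phi, delta_prime Phi &
      exists2 C : R, 0 < C &
        forall s t, 1 <= s -> 1 <= t -> Phi (s / t) <= C * Phi s / t `^ q].

Definition classUtilde Phi := exists2 q : R, 1 <= q & classUtilde_q q Phi.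

(* Inverse of a bijection of R_+. *)
Definition invRplus Phi : R -> R := 'pinv_(fun=> 0) Rplus Phi.

End growth_functions.

Definition nu (R : realType) (d n : nat) (sigma : 'I_n -> d.-tuple R -> R)
    (Phis : 'I_n -> R -> R) (Phi : R -> R) (x : d.-tuple R) : R :=
  (Phi (\prod_(i < n) invRplus (Phis i) (sigma i x)^-1))^-1.

Definition testing (R : realType) (d n : nat) (sigma : 'I_n -> d.-tuple R -> R)
    (omega : d.-tuple R -> R) (Phis : 'I_n -> R -> R) (Phi Psi : R -> R) :
    \bar R :=
  ereal_sup [set (wmeas omega Q *
    (Psi (invRplus Phi (fine (wmeas (nu sigma Phis Phi) Q))^-1))%:E)%E
    | Q in cubes].

(* Main.v *)
Require Import Defs.
From mathcomp Require Import all_boot all_order all_algebra.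
From mathcomp Require Import complex.
From mathcomp Require Import all_classical all_reals all_analysis.
From mathcomp Require Import measurable_realfun.
From mathcomp Require Import ring lra.
Import Order.TTheory GRing.Theory Num.Theory.
Import numFieldNormedType.Exports.

(** The classes of growth functions of the statement are rigid. If [Phi] has upper
    type q, is submultiplicative up to a constant and satisfies
    Phi (s / t) <= C Phi (s) / t^q for s, t >= 1, then [Phi] is comparable to t^q
    on the whole half-line ([classUtilde_power_like]); the nabla-2 condition adds
    q > 1, because the integral of 1 / s diverges at 0
    ([classUtilde_nabla2_exponent]). So [Phis i] is comparable to t^(e i) with
    e i > 1, [Psi] to t^q, the formula for the inverse makes [Phi] comparable to
    t^p with 1 / p the sum of the 1 / e i ([bijection_power_like]), and the
    monotonicity of Psi / Phi near 0 forces p <= q ([power_like_nd_exponent]).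
    The weight nu is comparable to the geometric mean
    v = prod_i sigma_i^(p / e i), and the testing condition becomes
    omega(Q) <= C A v(Q)^(q / p) for all cubes, with A the testing constant
    ([testing_geometric_weight]).

    For powers, the geometry is reduced to [3 ^ d] grids: every cube Q lies in a
    cell P of comparable side of one of them ([cube_in_grid]), and by doubling the
    averages over Q are at most a constant times those over P
    ([cube_average_le]). In one grid, with finitely many scales, let M be the
    maximal function over the cells. The testing condition is used on the cells of
    the finest scale only. On such a cell P the function M is constant, so

      int_P M^q omega <= C A (int_P M^p v)^(q / p),

    and since q / p >= 1 these inequalities add up to the same one on the whole
    space ([maximal_testing]). It remains to bound the integral of M^p v. As M is
    at most the product of the linear maximal functions M_i, M^p v is at most
    prod_i (M_i^(e i) sigma_i)^(p / e i), hence at most the sum of the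
    M_i^(e i) sigma_i ([strong_type]), and Doob's inequality for the measure
    sigma_i bounds each of these since e i > 1 ([doob]). Monotone convergence
    removes the restriction on the scales ([grid_majorant]).

    All this is applied to functions normalised by admissible Luxemburg radii; the
    infimum over the radii is taken at the end ([le_prod_ereal_inf]). *)

Set Implicit Arguments.
Unset Strict Implicit.
Unset Printing Implicit Defensive.

Local Open Scope classical_set_scope.
Local Open Scope ring_scope.

(** * Integrals of functions that are only comparable to measurable ones *)

Section lower_integral.
Local Open Scope ereal_scope.
Context d (T : measurableType d) (R : realType).
Variable mu : {measure set T -> \bar R}.
Implicit Types (D : set T) (f g : T -> \bar R).

Import HBNNSimple.

(** The integral of a nonnegative function is a supremum over the simple
    functions below it, so it is monotone without any measurability of the
    smaller function. This is what makes sense of integrals of weights that are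
    only almost everywhere equal to Borel functions, and of the maximal function,
    which is a supremum over uncountably many cubes. *)
Lemma integral_le_ae D f g : measurable D -> measurable_fun D g ->
  (forall x, D x -> 0 <= g x) -> {ae mu, forall x, D x -> f x <= g x} ->
  \int[mu]_(x in D) f x <= \int[mu]_(x in D) g x.
Proof.
move=> mD mg g0 [N [mN N0 fgN]].
rewrite integral_mkcond [leRHS]integral_mkcond integralE.
have mgD : measurable_fun setT (g \_ D) by exact/(measurable_restrictT _ _).1.
have gD0 x : 0 <= (g \_ D) x by exact: erestrict_ge0.
apply: (@le_trans _ _ (\int[mu]_x (f \_ D)^\+ x)).
  by rewrite -[leRHS]sube0; apply: leeB => //; exact: integral_ge0.
rewrite ge0_integralTE//; apply: ge_ereal_sup => _ [h /= hf <-].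
rewrite -integralT_nnsfun; apply: ae_ge0_le_integral => //.
- by move=> x _; rewrite lee_fin.
- exact/measurable_EFinP.
exists N; split => // x /= /not_implyP[_ hgx]; apply: fgN => /=.
apply: contra_not hgx => fgx; rewrite (le_trans (hf x))// funeposE ge_max.
rewrite gD0 andbT /patch; case: ifPn => // /set_mem; exact: fgx.
Qed.

(** Dually, only the smaller function has to be measurable; the larger one may be
    negative on a null set, which does not contribute. *)
Lemma le_integral_ae D f g : measurable D -> measurable_fun D g ->
  (forall x, D x -> 0 <= g x) -> {ae mu, forall x, D x -> g x <= f x} ->
  \int[mu]_(x in D) g x <= \int[mu]_(x in D) f x.
Proof.
move=> mD mg g0 [N [mN N0 fgN]].
rewrite integral_mkcond [leRHS]integral_mkcond [leRHS]integralE.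
have mgD : measurable_fun setT (g \_ D) by exact/(measurable_restrictT _ _).1.
have gD0 x : 0 <= (g \_ D) x by exact: erestrict_ge0.
have fgD x : ~ N x -> (g \_ D) x <= (f \_ D) x.
  move=> Nx; rewrite /patch; case: ifPn => // /set_mem Dx.
  by apply: contra_notP Nx => Nfg; apply: fgN => /= /(_ Dx).
have -> : \int[mu]_x (f \_ D)^\- x = 0.
  apply/eqP; rewrite eq_le integral_ge0// andbT -[leRHS](integral0 mu setT).
  apply: integral_le_ae => //.
  exists N; split => // x /= /not_implyP[_ Nx]; apply: contrapT => NNx.
  apply: Nx; rewrite funenegE ge_max lexx andbT leeNl oppe0.
  exact: le_trans (fgD _ NNx).
rewrite sube0 (ge0_negligible_integral _ _ _ _ N0)// setTD.
rewrite integral_mkcond !ge0_integralTE//; last first.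
  by move=> x; apply: erestrict_ge0.
apply: le_ereal_sup => _ [h /= hf <-]; exists h => //= x; rewrite (le_trans (hf x))//.
rewrite [leLHS]/patch; case: ifPn => [/set_mem Nx|_].
  by rewrite (le_trans (fgD _ Nx))// funeposE le_max lexx.
by rewrite funeposE le_max lexx orbT.
Qed.

Lemma integral_eq_ae D f g : measurable D -> measurable_fun D g ->
  (forall x, D x -> 0 <= g x) -> {ae mu, forall x, D x -> f x = g x} ->
  \int[mu]_(x in D) f x = \int[mu]_(x in D) g x.
Proof.
move=> mD mg g0 fg; apply/eqP; rewrite eq_le integral_le_ae ?le_integral_ae//.
  by apply: filterS fg => x fg Dx; rewrite fg.
by apply: filterS fg => x fg Dx; rewrite fg.
Qed.

Lemma integral_gt0 D f : measurable D -> measurable_fun D f ->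
  (forall x, D x -> 0 < f x) -> 0 < mu D -> 0 < \int[mu]_(x in D) f x.
Proof.
move=> mD mf f0 D0; rewrite lt0e integral_ge0 ?andbT; last first.
  by move=> x Dx; exact: ltW (f0 _ Dx).
apply/eqP => If0.
have : ae_eq mu D f (cst 0).
  apply/ae_eq_integral_abs => //; rewrite -[RHS]If0.
  by apply: eq_integral => x /set_mem Dx; rewrite gee0_abs// ltW// f0.
move=> [N [mN N0 DN]]; move: D0; rewrite lt0e => /andP[/eqP D0 _]; apply: D0.
apply: (subset_measure0 _ _ _ N0) => // x Dx; apply: DN => /= /(_ Dx) fx0.
by have := f0 _ Dx; rewrite fx0 ltxx.
Qed.

End lower_integral.

(** * Nonnegative measurable functions and nested countable partitions *)

Section nonneg_measurable.
Context d (T : measurableType d) (R : realType).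
Implicit Types f g : T -> R.

Definition nnmeas f := measurable_fun setT f /\ forall x, 0 <= f x.

Lemma nnmeasM f g : nnmeas f -> nnmeas g -> nnmeas (fun x => f x * g x).
Proof.
move=> [mf f0] [mg g0]; split; last by move=> x; exact: mulr_ge0.
exact: measurable_funM.
Qed.

Lemma nnmeasD f g : nnmeas f -> nnmeas g -> nnmeas (fun x => f x + g x).
Proof.
move=> [mf f0] [mg g0]; split; last by move=> x; exact: addr_ge0.
exact: measurable_funD.
Qed.

Lemma nnmeas_max f g : nnmeas f -> nnmeas g ->
  nnmeas (fun x => Num.max (f x) (g x)).
Proof.
move=> [mf f0] [mg g0]; split; last by move=> x; rewrite le_max f0.
exact: measurable_maxr.
Qed.

Lemma nnmeas_cst (c : R) : 0 <= c -> nnmeas (fun=> c).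
Proof. by move=> c0; split=> //; exact: measurable_cst. Qed.

Lemma nnmeas_powR f r : nnmeas f -> nnmeas (fun x => f x `^ r).
Proof.
move=> [mf f0]; split; last by move=> x; exact: powR_ge0.
exact: measurableT_comp (measurable_powR _) mf.
Qed.

Lemma nnmeas_sum (I : Type) (s : seq I) (F : I -> T -> R) :
  (forall i, nnmeas (F i)) -> nnmeas (fun x => \sum_(i <- s) F i x).
Proof.
move=> mF; elim: s => [|i s IH].
  by under eq_fun do rewrite big_nil; exact: nnmeas_cst.
by under eq_fun do rewrite big_cons; exact: nnmeasD.
Qed.

Lemma nnmeas_prod (I : Type) (s : seq I) (F : I -> T -> R) :
  (forall i, nnmeas (F i)) -> nnmeas (fun x => \prod_(i <- s) F i x).
Proof.
move=> mF; elim: s => [|i s IH].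
  by under eq_fun do rewrite big_nil; exact: nnmeas_cst.
by under eq_fun do rewrite big_cons; exact: nnmeasM.
Qed.

Variable mu : {measure set T -> \bar R}.
Local Open Scope ereal_scope.

Lemma nnmeas_EFin f (E : set T) : nnmeas f -> measurable_fun E (EFin \o f).
Proof.
by move=> [mf _]; apply/measurable_EFinP; exact: measurable_funTS.
Qed.

Lemma nnmeas_intZ f (c : R) E : measurable E -> nnmeas f -> (0 <= c)%R ->
  \int[mu]_(x in E) (c * f x)%:E = c%:E * \int[mu]_(x in E) (f x)%:E.
Proof.
move=> mE nf c0; under eq_integral do rewrite EFinM.
rewrite ge0_integralZl_EFin//; last exact: nnmeas_EFin.
by move=> x _; rewrite lee_fin nf.2.
Qed.

Lemma nnmeas_intD f g E : measurable E -> nnmeas f -> nnmeas g ->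
  \int[mu]_(x in E) (f x + g x)%:E =
  \int[mu]_(x in E) (f x)%:E + \int[mu]_(x in E) (g x)%:E.
Proof.
move=> mE nf ng; under eq_integral do rewrite EFinD.
rewrite ge0_integralD//; try exact: nnmeas_EFin.
  by move=> x _; rewrite lee_fin nf.2.
by move=> x _; rewrite lee_fin ng.2.
Qed.

Lemma nnmeas_int_le f g E : measurable E -> nnmeas f -> nnmeas g ->
  (forall x, E x -> f x <= g x)%R ->
  \int[mu]_(x in E) (f x)%:E <= \int[mu]_(x in E) (g x)%:E.
Proof.
move=> mE nf ng fg; apply: ge0_le_integral => //; try exact: nnmeas_EFin.
by move=> x _; rewrite lee_fin nf.2.
Qed.

Lemma nnmeas_int_sub f E F : measurable E -> measurable F -> nnmeas f ->
  E `<=` F ->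
  \int[mu]_(x in E) (f x)%:E <= \int[mu]_(x in F) (f x)%:E.
Proof.
move=> mE mF nf EF; apply: ge0_subset_integral => //; first exact: nnmeas_EFin.
by move=> x _; rewrite lee_fin nf.2.
Qed.

Lemma nnmeas_int_ge0 f E : nnmeas f -> 0 <= \int[mu]_(x in E) (f x)%:E.
Proof. by move=> nf; apply: integral_ge0 => x _; rewrite lee_fin nf.2. Qed.

Lemma nnmeas_int_sum (I : Type) (s : seq I) (F : I -> T -> R) E :
  measurable E -> (forall i, nnmeas (F i)) ->
  \int[mu]_(x in E) (\sum_(i <- s) F i x)%:E =
  \sum_(i <- s) \int[mu]_(x in E) (F i x)%:E.
Proof.
move=> mE mF; under eq_integral do rewrite -sumEFin.
rewrite ge0_integral_sum//; first by move=> i; exact: nnmeas_EFin.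
by move=> i x _; rewrite lee_fin (mF i).2.
Qed.

End nonneg_measurable.

Section partitions.
Context d (T : measurableType d) (R : realType) (J : countType).
Variable mu : {measure set T -> \bar R}.
Variable pi : nat -> T -> J.

(** The partition of level [k] is given by a labelling [pi k] of the points by a
    countable type; its cells are the fibres. *)
Definition cell k (x : T) : set T := [set y | pi k y = pi k x].

Definition nested_partitions :=
  (forall k j, measurable (pi k @^-1` [set j])) /\
  (forall k x y, pi k.+1 x = pi k.+1 y -> pi k x = pi k y).

Definition cellwise k (G : T -> R) :=
  forall x y, pi k x = pi k y -> G x = G y.

Hypothesis npi : nested_partitions.

Lemma measurable_cell k x : measurable (cell k x).
Proof. exact: npi.1. Qed.

Lemma nested_le k l x y : (k <= l)%N -> pi l x = pi l y -> pi k x = pi k y.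
Proof.
move=> /subnK <-; elim: (l - k)%N => [//|m IH].
by rewrite addSn => /npi.2/IH.
Qed.

Lemma cellwise_le k l G : (k <= l)%N -> cellwise k G -> cellwise l G.
Proof. by move=> kl cG x y /(nested_le kl)/cG. Qed.

Lemma measurable_cellwise k G : cellwise k G -> measurable_fun setT G.
Proof.
move=> cG _ B mB; rewrite setTI.
rewrite [X in measurable X](_ : _ = \bigcup_(j : J)
  (if `[< exists2 x, pi k x = j & B (G x) >] then pi k @^-1` [set j]
   else set0)); last first.
  apply/seteqP; split=> [x /= BGx|x [j _] /=].
    by exists (pi k x) => //; case: asboolP => //; case; exists x.
  case: asboolP => // -[y yj BGy] /= xj; rewrite (cG x y)//.
  by rewrite xj yj.
apply: countable_bigcupT_measurable; first exact: countableP.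
by move=> j; case: ifP => // _; exact: npi.1.
Qed.

Lemma nnmeas_cellwise k G : cellwise k G -> (forall x, 0 <= G x) -> nnmeas G.
Proof. by move=> cG G0; split=> //; exact: measurable_cellwise cG. Qed.

Local Open Scope ereal_scope.

(** A countable partition reduces an inequality between integrals to the same
    inequality on each cell. *)
Lemma le_integral_cells k (f g : T -> R) : nnmeas f -> nnmeas g ->
  (forall x, \int[mu]_(y in cell k x) (f y)%:E <=
             \int[mu]_(y in cell k x) (g y)%:E) ->
  \int[mu]_y (f y)%:E <= \int[mu]_y (g y)%:E.
Proof.
move=> nf ng fg; pose F i := [set y | pickle (pi k y) = i].
have mF i : measurable (F i).
  have [[x xi]|Nx] := pselect (exists x, pickle (pi k x) = i).
    rewrite (_ : F i = cell k x); first exact: measurable_cell.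
    apply/seteqP; split=> y; rewrite /F /cell/= -xi; last by move=> ->.
    exact: (pcan_inj pickleK).
  rewrite (_ : F i = set0)//; apply/seteqP; split => // y Fy.
  by apply: Nx; exists y.
have UF : setT = \bigcup_i F i.
  by apply/seteqP; split=> // y _; exists (pickle (pi k y)).
have tF : trivIset setT F.
  by apply/trivIsetP => i j _ _ ij; apply/seteqP; split=> // y [Fi Fj];
    move: ij; rewrite -Fi -Fj eqxx.
rewrite UF !ge0_integral_bigcup//; rewrite -?UF; try exact: nnmeas_EFin;
  try by move=> x _; rewrite lee_fin ?nf.2 ?ng.2.
apply: lee_nneseries => [i _ _|i _]; first exact: nnmeas_int_ge0.
have [[x xi]|Nx] := pselect (exists x, pickle (pi k x) = i).
  rewrite (_ : F i = cell k x)//.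
  apply/seteqP; split=> y; rewrite /F /cell/= -xi; last by move=> ->.
  exact: (pcan_inj pickleK).
rewrite (_ : F i = set0) ?integral_set0//; apply/seteqP; split => // y Fy.
by apply: Nx; exists y.
Qed.

Lemma eq_integral_cells k (f g : T -> R) : nnmeas f -> nnmeas g ->
  (forall x, \int[mu]_(y in cell k x) (f y)%:E =
             \int[mu]_(y in cell k x) (g y)%:E) ->
  \int[mu]_y (f y)%:E = \int[mu]_y (g y)%:E.
Proof.
move=> nf ng fg; apply/eqP; rewrite eq_le !(le_integral_cells (k := k))//.
all: by move=> x; rewrite fg.
Qed.

End partitions.

(** * Doob's maximal inequality for nested partitions *)

Section young.
Context (R : realType).
Implicit Types a b p : R.

Lemma young_powR1 p a b : 1 < p -> 0 <= a -> 0 <= b ->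
  p * (b * a `^ (p - 1)) <= b `^ p + (p - 1) * a `^ p.
Proof.
move=> p1 a0 b0; have p0 : 0 < p by rewrite (lt_trans ltr01).
have pm0 : 0 < p - 1 by rewrite subr_gt0.
have /= := @conjugate_powR R b (a `^ (p - 1)) p (p / (p - 1)) b0 (powR_ge0 _ _)
  p0 (divr_gt0 p0 pm0).
rewrite -powRrM mulrCA divff ?gt_eqF// mulr1 invf_div.
have -> : p^-1 + (p - 1) / p = 1.
  by rewrite -{1}(mul1r p^-1) -mulrDl addrC subrK divff// gt_eqF.
move=> /(_ erefl) h; rewrite -(ler_pM2l p0) in h; apply: (le_trans h).
rewrite mulrDr mulrCA divff ?gt_eqF// mulr1 lerD2l.
by rewrite [leLHS](_ : _ = (p - 1) * a `^ p)//; field; rewrite gt_eqF.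
Qed.

(** The factor 2 in front of the conjugate exponent is what leaves only one half
    of [a `^ p] on the right, to be absorbed in the left-hand side of Doob's
    inequality. *)
Lemma young_absorb p a b : 1 < p -> 0 <= a -> 0 <= b ->
  p / (p - 1) * (b * a `^ (p - 1)) <=
  (2 * (p / (p - 1))) `^ p * b `^ p + 2^-1 * a `^ p.
Proof.
move=> p1 a0 b0; have p0 : 0 < p by rewrite (lt_trans ltr01).
have pm0 : 0 < p - 1 by rewrite subr_gt0.
set c := p / (p - 1); have c1 : 1 <= c.
  by rewrite ler_pdivlMr// mul1r gerBl.
have c0 : 0 < c by rewrite (lt_le_trans ltr01).
have := @conjugate_powR R (2 * c * b) (a `^ (p - 1) / 2) p c _ _ p0 c0.
have -> : p^-1 + c^-1 = 1.
  by rewrite invf_div -{1}(mul1r p^-1) -mulrDl addrC subrK divff// gt_eqF.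
have -> : 2 * c * b * (a `^ (p - 1) / 2) = c * (b * a `^ (p - 1)).
  by rewrite !mulrA mulrC -!mulrA mulKf ?pnatr_eq0.
have c20 : 0 <= 2 * c by rewrite mulr_ge0// ltW.
move=> h; apply: (le_trans (h _ _ erefl)).
- by rewrite mulr_ge0.
- by rewrite divr_ge0 ?powR_ge0.
apply: lerD.
  rewrite (powRM _ c20 b0) ler_pdivrMr// ler_peMr ?(ltW p1)//.
  by rewrite mulr_ge0 ?powR_ge0.
rewrite powRM ?powR_ge0 ?invr_ge0// -powRrM mulrCA divff ?gt_eqF// mulr1.
rewrite -mulrA [leRHS]mulrC ler_wpM2l ?powR_ge0//.
have h2 : (2^-1 : R) `^ c <= 2^-1.
  by rewrite ge1r_powR// invr_gt0 ltr0n/= invf_le1 ?ler1n.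
by rewrite ler_pdivrMr// (le_trans h2)// ler_peMr ?invr_ge0.
Qed.

Lemma young_shift p a b t : p * t <= a + (p - 1) * b ->
  (p - 1) * (a - b) <= p * (a - t).
Proof. lra. Qed.

Lemma absorb_half a b t : a <= t * b + 2^-1 * a -> a <= 2 * t * b.
Proof. lra. Qed.

Lemma ler_1D_powR p a : 1 <= p -> 0 <= a -> a <= 1 + a `^ p.
Proof.
move=> p1 a0; have [a1|a1] := leP a 1.
  by rewrite (le_trans a1)// lerDl powR_ge0.
by rewrite (le_trans (le1r_powR (ltW a1) p1))// lerDr.
Qed.

End young.

Section running_maximum.
Context (T : Type) (R : realType).

Fixpoint runmax (a : nat -> T -> R) K x :=
  if K is K'.+1 then Num.max (runmax a K' x) (a K x) else a 0 x.

Lemma runmax_ge0 a K x : (forall k y, 0 <= a k y) -> 0 <= runmax a K x.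
Proof. by move=> a0; elim: K => //= K IH; rewrite le_max IH. Qed.

Lemma le_runmax a k K x : (k <= K)%N -> a k x <= runmax a K x.
Proof.
elim: K => [|K IH]; first by rewrite leqn0 => /eqP->.
rewrite leq_eqVlt => /predU1P[->|/IH h] /=; first by rewrite le_max lexx orbT.
by rewrite le_max h.
Qed.

Lemma runmax_le a K x c : (forall k, (k <= K)%N -> a k x <= c) ->
  runmax a K x <= c.
Proof.
elim: K => [|K IH] h /=; first exact: h.
by rewrite ge_max IH ?h// => k kK; apply/h/leqW.
Qed.

End running_maximum.

(** A function in L^p(w) is integrable where [w] is, since f <= 1 + f^p. *)
Lemma int_lty_powR d (T : measurableType d) (R : realType)
    (mu : {measure set T -> \bar R}) (E : set T) (w f : T -> R) (p : R) :
  measurable E -> nnmeas w -> nnmeas f -> 1 <= p ->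
  (\int[mu]_(y in E) (w y)%:E < +oo)%E ->
  (\int[mu]_y (f y `^ p * w y)%:E < +oo)%E ->
  (\int[mu]_(y in E) (f y * w y)%:E < +oo)%E.
Proof.
move=> mE nw nf p1 woo fwoo.
have nfw : nnmeas (fun y => f y * w y) by exact: nnmeasM.
have nfpw : nnmeas (fun y => f y `^ p * w y).
  by apply: nnmeasM => //; exact: nnmeas_powR.
apply: (@le_lt_trans _ _ (\int[mu]_(y in E) (w y + f y `^ p * w y)%:E)%E).
  apply: nnmeas_int_le => //; first exact: nnmeasD.
  move=> y _; rewrite -[X in X + _]mul1r -mulrDl ler_wpM2r ?nw.2//.
  by rewrite ler_1D_powR ?nf.2.
rewrite (nnmeas_intD mu mE nw nfpw); apply: (lte_add_pinfty woo).
by apply: le_lt_trans fwoo; exact: nnmeas_int_sub.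
Qed.

Section doob.
Context d (T : measurableType d) (R : realType) (J : countType).
Variables (mu : {measure set T -> \bar R}) (pi : nat -> T -> J).

Definition cavg (w f : T -> R) k x : R :=
  fine (\int[mu]_(y in cell pi k x) (f y * w y)%:E) /
  fine (\int[mu]_(y in cell pi k x) (w y)%:E).

Hypothesis npi : nested_partitions pi.
Variable w : T -> R.
Hypothesis nw : nnmeas w.
Hypothesis w_cell : forall k x,
  (0 < \int[mu]_(y in cell pi k x) (w y)%:E < +oo)%E.

Let w_fin k x : (\int[mu]_(y in cell pi k x) (w y)%:E)%E \is a fin_num.
Proof.
have /andP[w0 woo] := w_cell k x.
by rewrite ge0_fin_numE// ltW.
Qed.

Lemma cellwise_runmax (a : nat -> T -> R) K :
  (forall k, cellwise pi k (a k)) -> cellwise pi K (runmax a K).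
Proof.
move=> ca; elim: K => [|K IH] /=; first exact: ca.
move=> x y xy; rewrite (ca K.+1 x y)// (IH x y)//; exact: npi.2.
Qed.

Lemma cavg_ge0 f k x : nnmeas f -> 0 <= cavg w f k x.
Proof.
move=> nf; rewrite divr_ge0// fine_ge0//; apply: nnmeas_int_ge0 => //.
exact: nnmeasM.
Qed.

Lemma eq_cell k x y : pi k x = pi k y -> cell pi k x = cell pi k y.
Proof. by rewrite /cell => ->. Qed.

Lemma cellwise_cavg f k : cellwise pi k (cavg w f k).
Proof. by move=> x y /eq_cell xy; rewrite /cavg xy. Qed.

Section one_function.
Variable f : T -> R.
Hypothesis nf : nnmeas f.

Lemma cavgE k x :
  (\int[mu]_(y in cell pi k x) (f y * w y)%:E < +oo)%E ->
  ((cavg w f k x)%:E * \int[mu]_(y in cell pi k x) (w y)%:E =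
  \int[mu]_(y in cell pi k x) (f y * w y)%:E)%E.
Proof.
move=> foo; have ffin : (\int[mu]_(y in cell pi k x) (f y * w y)%:E)%E \is a fin_num.
  by rewrite ge0_fin_numE//; apply: nnmeas_int_ge0; exact: nnmeasM.
rewrite -[in LHS](fineK (w_fin k x)) -EFinM /cavg divfK ?fineK//.
have /andP[w0 woo] := w_cell k x.
by rewrite gt_eqF// fine_gt0// w0 woo.
Qed.

(** Conditional expectation is self-adjoint: tested against a function that
    is constant on the cells of level [k], [f] can be replaced by its cell
    averages. *)
Lemma cavg_duality k G :
  (forall x, (\int[mu]_(y in cell pi k x) (f y * w y)%:E < +oo)%E) ->
  cellwise pi k G -> (forall x, 0 <= G x) ->
  (\int[mu]_y (cavg w f k y * (G y * w y))%:E =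
   \int[mu]_y (f y * (G y * w y))%:E)%E.
Proof.
move=> foo cG G0; have nG := nnmeas_cellwise npi cG G0.
have nA : nnmeas (cavg w f k).
  apply: nnmeas_cellwise (@cellwise_cavg f k) _ => // x; exact: cavg_ge0.
apply: (eq_integral_cells (k := k) npi).
- by apply: nnmeasM => //; exact: nnmeasM.
- by apply: nnmeasM => //; exact: nnmeasM.
move=> x; have mC := measurable_cell npi k x.
transitivity (\int[mu]_(y in cell pi k x) (G x * (cavg w f k x * w y))%:E)%E.
  apply: eq_integral => y /set_mem yx; rewrite (cG _ _ yx).
  by rewrite (@cellwise_cavg f k _ _ yx) mulrCA.
transitivity (\int[mu]_(y in cell pi k x) (G x * (f y * w y))%:E)%E; last first.
  apply: eq_integral => y /set_mem yx; rewrite (cG _ _ yx).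
  by rewrite mulrCA.
rewrite !nnmeas_intZ ?cavg_ge0//; try exact: nnmeasM.
  by rewrite cavgE.
by apply: nnmeasM => //; exact/nnmeas_cst/cavg_ge0.
Qed.

Variable p : R.
Hypothesis p1 : 1 < p.
Hypothesis fp : (\int[mu]_y (f y `^ p * w y)%:E < +oo)%E.

Let p0 : 0 < p. Proof. exact: lt_trans ltr01 p1. Qed.
Let pm0 : 0 < p - 1. Proof. by rewrite subr_gt0. Qed.
Let nfw : nnmeas (fun y => f y * w y). Proof. exact: nnmeasM. Qed.
Let nfpw : nnmeas (fun y => f y `^ p * w y).
Proof. by apply: nnmeasM => //; exact: nnmeas_powR. Qed.

Lemma int_powR_cell k x :
  (\int[mu]_(y in cell pi k x) (f y `^ p * w y)%:E < +oo)%E.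
Proof.
apply: le_lt_trans fp; apply: nnmeas_int_sub => //; exact: measurable_cell.
Qed.

Lemma int_cell_lty k x : (\int[mu]_(y in cell pi k x) (f y * w y)%:E < +oo)%E.
Proof.
have /andP[_ woo] := w_cell k x.
exact: (int_lty_powR (measurable_cell npi k x) nw nf (ltW p1) woo fp).
Qed.

(** Jensen's inequality, obtained by integrating over a cell the tangent (Young)
    inequality at the average. It is used for finiteness, which the absorption
    argument for Doob's inequality requires. *)
Lemma cavg_jensen k :
  (\int[mu]_y (cavg w f k y `^ p * w y)%:E <=
   \int[mu]_y (f y `^ p * w y)%:E)%E.
Proof.
have nA : nnmeas (fun y => cavg w f k y).
  apply: nnmeas_cellwise (@cellwise_cavg f k) _ => // x; exact: cavg_ge0.
have nApw : nnmeas (fun y => cavg w f k y `^ p * w y).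
  by apply: nnmeasM => //; exact: nnmeas_powR.
apply: (le_integral_cells (k := k) npi nApw nfpw) => x.
have mC := measurable_cell npi k x.
set a := cavg w f k x; have a0 : 0 <= a by exact: cavg_ge0.
set C := cell pi k x.
have -> : (\int[mu]_(y in C) (cavg w f k y `^ p * w y)%:E =
    (a `^ p)%:E * \int[mu]_(y in C) (w y)%:E)%E.
  transitivity (\int[mu]_(y in C) (a `^ p * w y)%:E)%E; last first.
    by apply: nnmeas_intZ => //; exact: powR_ge0.
  apply: eq_integral => y /set_mem yx.
  by rewrite (@cellwise_cavg f k _ _ yx).
have h : (\int[mu]_(y in C) (p * a `^ (p - 1) * (f y * w y))%:E <=
   \int[mu]_(y in C) (f y `^ p * w y + (p - 1) * a `^ p * w y)%:E)%E.
  apply: nnmeas_int_le => //.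
  - by apply: nnmeasM => //; apply: nnmeas_cst; rewrite mulr_ge0 ?powR_ge0 ?ltW.
  - apply: nnmeasD => //; apply: nnmeasM => //; apply: nnmeas_cst.
    by rewrite mulr_ge0 ?powR_ge0 ?ltW.
  move=> y _; rewrite mulrA -mulrDl ler_wpM2r ?nw.2//.
  by rewrite -mulrA (mulrC (_ `^ _)) young_powR1// nf.2.
move: h; rewrite nnmeas_intZ//; last by rewrite mulr_ge0 ?powR_ge0 ?ltW.
rewrite nnmeas_intD//; last first.
  apply: nnmeasM => //; apply: nnmeas_cst.
  by rewrite mulr_ge0 ?powR_ge0 ?ltW.
rewrite nnmeas_intZ//; last by rewrite mulr_ge0 ?powR_ge0 ?ltW.
rewrite -cavgE; last exact: int_cell_lty.
have : (\int[mu]_(y in C) (f y `^ p * w y)%:E)%E \is a fin_num.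
  by rewrite ge0_fin_numE ?int_powR_cell// nnmeas_int_ge0.
rewrite -/C -/a -(fineK (w_fin k x)) => /fineK <-.
rewrite -!EFinM -EFinD !lee_fin.
rewrite mulrA -[p * _ * a]mulrA [_ `^ (p-1) * a]mulrC mulr_powRB1//.
lra.
Qed.

Local Notation S K := (runmax (cavg w f) K).

Let nS K : nnmeas (S K).
Proof.
apply: nnmeas_cellwise (@cellwise_runmax _ K (@cellwise_cavg f)) _ => // x.
by apply: runmax_ge0 => k y; exact: cavg_ge0.
Qed.

Let S0 K x : 0 <= S K x. Proof. exact: (nS K).2. Qed.

Lemma runmax_powR_lty K : (\int[mu]_y (S K y `^ p * w y)%:E < +oo)%E.
Proof.
elim: K => [|K IH] /=; first exact: le_lt_trans (cavg_jensen 0) fp.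
have nA : nnmeas (fun y => cavg w f K.+1 y).
  apply: nnmeas_cellwise (@cellwise_cavg f _) _ => // x; exact: cavg_ge0.
apply: (@le_lt_trans _ _
  (\int[mu]_y (S K y `^ p * w y + cavg w f K.+1 y `^ p * w y)%:E)%E).
  apply: nnmeas_int_le => //.
  - by apply: nnmeasM => //; apply: nnmeas_powR; exact: nnmeas_max.
  - by apply: nnmeasD => //; apply: nnmeasM => //; exact: nnmeas_powR.
  move=> x _; rewrite -mulrDl ler_wpM2r ?nw.2//.
  have [_|_] := leP (S K x) (cavg w f K.+1 x).
    by rewrite lerDr powR_ge0.
  by rewrite lerDl powR_ge0.
rewrite nnmeas_intD//; try by apply: nnmeasM => //; exact: nnmeas_powR.
exact: (lte_add_pinfty IH (le_lt_trans (cavg_jensen K.+1) fp)).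
Qed.

(** Discrete form of d(S^p) = p' S d(S^(p-1)), p' = p / (p - 1): the running
    maximum only moves at levels where it equals the new average, so the factor
    [S] may be replaced by this average, hence under the integral by [f]
    itself. *)
Lemma doob_duality K :
  (\int[mu]_y (S K y `^ p * w y)%:E <=
   (p / (p - 1))%:E * \int[mu]_y (f y * (S K y `^ (p - 1) * w y))%:E)%E.
Proof.
set c := p / (p - 1); have c0 : 0 < c by exact: divr_gt0.
have c1 : 1 <= c by rewrite ler_pdivlMr// mul1r gerBl.
have nSp K' r : nnmeas (fun y => S K' y `^ r * w y).
  by apply: nnmeasM => //; exact: nnmeas_powR.
have nA k : nnmeas (fun y => cavg w f k y).
  apply: nnmeas_cellwise (@cellwise_cavg f _) _ => // x; exact: cavg_ge0.
elim: K => [|K IH].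
  have <- := cavg_duality (k := 0) (int_cell_lty 0) (G := fun y => S 0 y `^ (p - 1)); last 2 first.
    by move=> x y xy; rewrite /= (@cellwise_cavg f _ _ _ xy).
    by move=> x; exact: powR_ge0.
  rewrite -[leLHS]mul1e; apply: lee_pmul => //.
  - exact: nnmeas_int_ge0.
  apply: nnmeas_int_le => //; first exact: nnmeasM.
  by move=> x _ /=; rewrite mulrA mulr_powRB1// cavg_ge0.
(* [G] is nonnegative and constant on the cells of level [K.+1], so it is an
   admissible test function for the averages of that level. *)
pose G y := S K.+1 y `^ (p - 1) - S K y `^ (p - 1).
have SS x : S K x <= S K.+1 x by rewrite /= le_max lexx.
have G0 x : 0 <= G x.
  by rewrite subr_ge0 ge0_ler_powR ?nnegrE// ltW.
have cG : cellwise pi K.+1 G.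
  have h k : (k <= K.+1)%N -> cellwise pi K.+1 (S k).
    move=> kK; apply: (cellwise_le npi kK); apply: cellwise_runmax.
    exact: cellwise_cavg.
  by move=> x y xy; rewrite /G (h _ _ x y)// (h K _ x y).
have nG := nnmeas_cellwise npi cG G0.
apply: (@le_trans _ _ (\int[mu]_y
    (S K y `^ p * w y + c * (cavg w f K.+1 y * (G y * w y)))%:E)%E).
  apply: nnmeas_int_le => //.
    apply: nnmeasD => //; apply: nnmeasM; first exact/nnmeas_cst/ltW.
    by apply: nnmeasM => //; exact: nnmeasM.
  move=> x _; rewrite [in leRHS]mulrA [in leRHS]mulrA -mulrDl ler_wpM2r ?nw.2//.
  rewrite -lerBlDl; have := SS x; rewrite le_eqVlt => /predU1P[eS|ltS].
    by rewrite /G -eS !subrr mulr0.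
  have -> : cavg w f K.+1 x = S K.+1 x.
    move: ltS => /=.
    by have [_|_] := leP (S K x) (cavg w f K.+1 x); rewrite ?ltxx.
  have h := young_powR1 p1 (S0 K x) (S0 K.+1 x).
  have e := mulr_powRB1 (S0 K.+1 x) p0.
  have ec z : (p - 1) * (c * z) = p * z.
    by rewrite mulrA [(p - 1) * _]mulrC divfK ?gt_eqF.
  rewrite -(ler_pM2l pm0) -[c * _ * _]mulrA ec /G [S K.+1 x * _]mulrBr e.
  exact: young_shift h.
have nAGw : nnmeas (fun y => cavg w f K.+1 y * (G y * w y)).
  by apply: nnmeasM => //; exact: nnmeasM.
have nfGw : nnmeas (fun y => f y * (G y * w y)).
  by apply: nnmeasM => //; exact: nnmeasM.
have nfSw k : nnmeas (fun y => f y * (S k y `^ (p - 1) * w y)).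
  by apply: nnmeasM => //; exact: nnmeasM.
have ncA : nnmeas (fun y => c * (cavg w f K.+1 y * (G y * w y))).
  by apply: nnmeasM => //; exact/nnmeas_cst/ltW.
rewrite (nnmeas_intD mu measurableT (nSp K p) ncA).
rewrite (nnmeas_intZ mu measurableT nAGw (ltW c0)).
rewrite (cavg_duality (int_cell_lty K.+1) cG G0).
apply: (le_trans (leeD2r _ IH)).
rewrite -ge0_muleDr; [|exact: nnmeas_int_ge0|exact: nnmeas_int_ge0].
rewrite -(nnmeas_intD mu measurableT (nfSw K) nfGw).
rewrite le_eqVlt; apply/orP; left; apply/eqP; congr (_ * _)%E.
by apply: eq_integral => x _; rewrite -mulrDr -mulrDl /G addrC subrK.
Qed.

Definition doob_const (q : R) := 2 * (2 * (q / (q - 1))) `^ q.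

(** By duality the left-hand side is at most p' times the integral of
    f S^(p-1); Young's inequality splits this product and half of the integral of
    S^p is absorbed. *)
Theorem doob K :
  (\int[mu]_y (S K y `^ p * w y)%:E <=
   (doob_const p)%:E * \int[mu]_y (f y `^ p * w y)%:E)%E.
Proof.
have nSp r : nnmeas (fun y => S K y `^ r * w y).
  by apply: nnmeasM => //; exact: nnmeas_powR.
set D := (2 * (p / (p - 1))) `^ p.
have D0 : 0 <= D by exact: powR_ge0.
have h : (\int[mu]_y (S K y `^ p * w y)%:E <=
    D%:E * \int[mu]_y (f y `^ p * w y)%:E +
    (2^-1)%:E * \int[mu]_y (S K y `^ p * w y)%:E)%E.
  apply: (le_trans (doob_duality K)).
  have c0 : 0 <= p / (p - 1) by rewrite divr_ge0 ?ltW.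
  have e1 := nnmeas_intZ mu measurableT nfpw D0.
  have e2 := nnmeas_intZ mu measurableT (nSp p) (_ : 0 <= 2^-1).
  have e3 := nnmeas_intZ mu measurableT (nnmeasM nf (nSp (p - 1))) c0.
  rewrite -e1 -e2 ?invr_ge0// -e3.
  have n1 : nnmeas (fun y => D * (f y `^ p * w y)).
    by apply: nnmeasM => //; exact: nnmeas_cst.
  have n2 : nnmeas (fun y => 2^-1 * (S K y `^ p * w y)).
    by apply: nnmeasM => //; apply: nnmeas_cst; rewrite invr_ge0.
  have n3 : nnmeas (fun y => p / (p - 1) * (f y * (S K y `^ (p - 1) * w y))).
    by apply: nnmeasM; [exact: nnmeas_cst|exact: nnmeasM].
  rewrite -(nnmeas_intD mu measurableT n1 n2).
  apply: nnmeas_int_le => //; first exact: nnmeasD.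
  move=> x _; rewrite !mulrA -mulrDl ler_wpM2r ?nw.2//.
  by rewrite -[in leLHS]mulrA young_absorb// nf.2.
have fS : (\int[mu]_y (S K y `^ p * w y)%:E)%E \is a fin_num.
  by rewrite ge0_fin_numE; [exact: runmax_powR_lty|exact: nnmeas_int_ge0].
have ff : (\int[mu]_y (f y `^ p * w y)%:E)%E \is a fin_num.
  by rewrite ge0_fin_numE//; exact: nnmeas_int_ge0.
move: h; rewrite -(fineK fS) -(fineK ff) -!EFinM -EFinD !lee_fin.
exact: absorb_half.
Qed.

End one_function.
End doob.

(** * The multilinear maximal function of a finite tower of partitions *)

Section products_of_powers.
Context (R : realType).

Lemma prod_powR_exp (I : Type) (s : seq I) (a : R) (r : I -> R) : 0 < a ->
  \prod_(i <- s) a `^ r i = a `^ (\sum_(i <- s) r i).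
Proof.
move=> a0; elim: s => [|i s IH]; first by rewrite !big_nil powRr0.
by rewrite !big_cons IH powRD// (gt_eqF a0) implybT.
Qed.

Lemma powR_prod (I : Type) (s : seq I) (x : I -> R) (r : R) :
  (forall i, 0 <= x i) -> (\prod_(i <- s) x i) `^ r = \prod_(i <- s) x i `^ r.
Proof.
move=> x0; elim: s => [|i s IH]; first by rewrite !big_nil powR1.
by rewrite !big_cons powRM ?IH// prodr_ge0.
Qed.

(** Crude weighted AM-GM inequality, with the maximum, hence the sum, on the
    right-hand side. *)
Lemma prod_powR_le_sum n (x r : 'I_n -> R) : (forall i, 0 <= x i) ->
  (forall i, 0 < r i) -> \sum_(i < n) r i = 1 ->
  \prod_(i < n) x i `^ r i <= \sum_(i < n) x i.
Proof.
move=> x0 r0 r1; set s := \sum_(i < n) x i.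
have xs i : x i <= s by rewrite /s (bigD1 i)//= lerDl sumr_ge0.
have s0 : 0 <= s by rewrite sumr_ge0.
apply: (@le_trans _ _ (\prod_(i < n) s `^ r i)).
  apply: ler_prod => i _; rewrite powR_ge0/= ge0_ler_powR ?nnegrE//.
  exact: ltW.
move: s0; rewrite le_eqVlt => /predU1P[<-|s0]; last first.
  by rewrite prod_powR_exp// r1 powRr1// ltW.
case: n x r x0 r0 r1 @s xs => [|n] x r _ r0 r1 _ _.
  by rewrite big_ord0 in r1; have := oner_neq0 R; rewrite -r1 eqxx.
by rewrite (bigD1 ord0)//= powR0 ?mul0r// gt_eqF.
Qed.

End products_of_powers.

Section multilinear.
Context d (T : measurableType d) (R : realType) (J : countType).
Variables (mu : {measure set T -> \bar R}) (pi : nat -> T -> J).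
Hypothesis npi : nested_partitions pi.
Variables (n : nat) (w f : 'I_n -> T -> R) (e : 'I_n -> R) (p q : R).
Hypothesis nw : forall i, nnmeas (w i).
Hypothesis w_cell : forall i k x,
  (0 < \int[mu]_(y in cell pi k x) (w i y)%:E < +oo)%E.
Hypothesis nf : forall i, nnmeas (f i).
Hypothesis e1 : forall i, 1 < e i.
Hypothesis p0 : 0 < p.
Hypothesis pe : \sum_(i < n) p / e i = 1.
Hypothesis pq : p <= q.

(** When each growth function is the power [t `^ e i], this is the weight nu of
    the testing condition. *)
Definition geometric_weight x := \prod_(i < n) w i x `^ (p / e i).

Definition mcavg k x := \prod_(i < n) cavg mu pi (w i) (f i) k x.

Let e0 i : 0 < e i. Proof. exact: lt_trans ltr01 (e1 i). Qed.

Lemma nnmeas_geometric_weight : nnmeas geometric_weight.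
Proof. by apply: nnmeas_prod => i; exact: nnmeas_powR. Qed.

Lemma geometric_weight_le x : geometric_weight x <= \sum_(i < n) w i x.
Proof.
apply: prod_powR_le_sum => // i; [exact: (nw i).2|exact: divr_gt0].
Qed.

Let nV := nnmeas_geometric_weight.

Let a0 i k x : 0 <= cavg mu pi (w i) (f i) k x. Proof. exact: cavg_ge0. Qed.

Let M K := runmax mcavg K.

Let M0 K x : 0 <= M K x.
Proof. by apply: runmax_ge0 => k y; exact: prodr_ge0. Qed.

Lemma cellwise_runmax_mcavg K : cellwise pi K (runmax mcavg K).
Proof.
apply: cellwise_runmax => // k x y xy; apply: eq_bigr => i _.
exact: (@cellwise_cavg _ _ _ _ _ _ _ _ k).
Qed.

Lemma nnmeas_runmax_mcavg K : nnmeas (runmax mcavg K).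
Proof. exact: (nnmeas_cellwise npi (@cellwise_runmax_mcavg K) (M0 K)). Qed.

Let nM K : nnmeas (M K). Proof. exact: nnmeas_runmax_mcavg. Qed.

Variable B : 'I_n -> R.
Hypothesis fB : forall i, (\int[mu]_y (f i y `^ e i * w i y)%:E <= (B i)%:E)%E.

Definition strong_const := \sum_(i < n) doob_const (e i) * B i.

(** The multilinear maximal function is dominated by the product of the linear
    ones, and the geometric weight splits the product. *)
Lemma strong_type K :
  (\int[mu]_y (M K y `^ p * geometric_weight y)%:E <= strong_const%:E)%E.
Proof.
pose S i := runmax (cavg mu pi (w i) (f i)) K.
have nS i : nnmeas (S i).
  apply: (nnmeas_cellwise npi (k := K)).
    by apply: cellwise_runmax => // k; exact: cellwise_cavg.
  by move=> x; apply: runmax_ge0.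
have S0 i x : 0 <= S i x := (nS i).2 x.
have nSw i : nnmeas (fun y => S i y `^ e i * w i y).
  by apply: nnmeasM => //; exact: nnmeas_powR.
have MS x : M K x <= \prod_(i < n) S i x.
  apply: runmax_le => k kK; apply: ler_prod => i _; rewrite a0/=.
  exact: (le_runmax (cavg mu pi (w i) (f i))).
apply: (@le_trans _ _ (\int[mu]_y (\sum_(i < n) S i y `^ e i * w i y)%:E)%E).
  apply: nnmeas_int_le => //.
  - by apply: nnmeasM => //; exact: nnmeas_powR.
  - exact: nnmeas_sum.
  move=> x _.
  apply: (@le_trans _ _ (\prod_(i < n) (S i x `^ e i * w i x) `^ (p / e i))).
    under [leRHS]eq_bigr => i _.
      rewrite powRM ?powR_ge0 ?(nw i).2// -powRrM mulrCA divff ?gt_eqF// mulr1.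
      over.
    rewrite big_split/= ler_wpM2r ?nV.2// -powR_prod//.
    by rewrite ge0_ler_powR ?nnegrE ?M0 ?prodr_ge0// ltW.
  apply: prod_powR_le_sum => // i; [exact: (nSw i).2|exact: divr_gt0].
rewrite nnmeas_int_sum// -sumEFin; apply: lee_sum => i _.
have fBoo : (\int[mu]_y (f i y `^ e i * w i y)%:E < +oo)%E.
  exact: le_lt_trans (fB i) (ltry _).
apply: (le_trans (doob npi (nw i) (w_cell i) (nf i) (e1 i) fBoo K)).
rewrite [leRHS]EFinM; apply: lee_wpmul2l => //.
by rewrite lee_fin mulr_ge0// powR_ge0.
Qed.

Variables (omega : T -> R) (A : R) (K : nat).
Hypothesis nomega : nnmeas omega.
Hypothesis A0 : 0 <= A.
Hypothesis omega_test : forall x,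
  (\int[mu]_(y in cell pi K x) (omega y)%:E <= (A *
   fine (\int[mu]_(y in cell pi K x) (geometric_weight y)%:E) `^ (q / p))%:E)%E.

Lemma geometric_weight_cell k x :
  (\int[mu]_(y in cell pi k x) (geometric_weight y)%:E < +oo)%E.
Proof.
have mC := measurable_cell npi k x.
apply: (@le_lt_trans _ _ (\int[mu]_(y in cell pi k x) (\sum_(i < n) w i y)%:E)%E).
  apply: nnmeas_int_le => //; first exact: nnmeas_sum.
  by move=> y _; exact: geometric_weight_le.
rewrite nnmeas_int_sum//; apply: lte_sum_pinfty => i _.
by have /andP[] := w_cell i k x.
Qed.

(** The maximal function of level [K] is constant on the cells of level [K], so
    the testing condition on these finest cells alone, raised to a power at
    least one, transfers the bound from the geometric weight to [omega]. *)
Theorem maximal_testing :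
  (\int[mu]_y (M K y `^ q * omega y)%:E <=
   (A * strong_const `^ (q / p))%:E)%E.
Proof.
have st := strong_type K; set N := strong_const in st *.
have nMV : nnmeas (fun y => M K y `^ p * geometric_weight y).
  by apply: nnmeasM => //; exact: nnmeas_powR.
have N0 : 0 <= N.
  by rewrite -lee_fin; apply: le_trans st; exact: nnmeas_int_ge0.
set s := q / p; have s1 : 0 <= s - 1 by rewrite subr_ge0 ler_pdivlMr// mul1r.
have s0 : 0 < s by rewrite divr_gt0// (lt_le_trans p0).
have c0 : 0 <= A * N `^ (s - 1) by rewrite mulr_ge0 ?powR_ge0.
apply: (@le_trans _ _ ((A * N `^ (s - 1))%:E *
    \int[mu]_y (M K y `^ p * geometric_weight y)%:E)%E); last first.
  apply: (@le_trans _ _ ((A * N `^ (s - 1))%:E * N%:E)%E).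
    by apply: lee_wpmul2l => //; rewrite lee_fin.
  by rewrite -EFinM -mulrA [_ * N]mulrC mulr_powRB1.
rewrite -(nnmeas_intZ mu measurableT nMV c0).
have nMo : nnmeas (fun y => M K y `^ q * omega y).
  by apply: nnmeasM => //; exact: nnmeas_powR.
have nc : nnmeas (fun y => A * N `^ (s - 1) * (M K y `^ p * geometric_weight y)).
  by apply: nnmeasM => //; exact: nnmeas_cst.
apply: (le_integral_cells (k := K) npi nMo nc) => x.
have mC := measurable_cell npi K x.
rewrite (nnmeas_intZ mu mC nMV c0).
have cM y : cell pi K x y -> M K y = M K x.
  exact: cellwise_runmax_mcavg.
set C := cell pi K x in cM mC *.
pose V := fine (\int[mu]_(y in C) (geometric_weight y)%:E)%E.
have VE : (\int[mu]_(y in C) (geometric_weight y)%:E = V%:E)%E.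
  rewrite fineK// ge0_fin_numE; first exact: geometric_weight_cell.
  exact: nnmeas_int_ge0.
have V0 : 0 <= V by rewrite -lee_fin -VE; exact: nnmeas_int_ge0.
have IV : (\int[mu]_(y in C) (M K y `^ p * geometric_weight y)%:E =
    (M K x `^ p * V)%:E)%E.
  transitivity (\int[mu]_(y in C) (M K x `^ p * geometric_weight y)%:E)%E.
    by apply: eq_integral => y /set_mem/cM ->.
  by rewrite (nnmeas_intZ mu mC nV (powR_ge0 _ _)) VE.
have IO : (\int[mu]_(y in C) (M K y `^ q * omega y)%:E =
    (M K x `^ q)%:E * \int[mu]_(y in C) (omega y)%:E)%E.
  transitivity (\int[mu]_(y in C) (M K x `^ q * omega y)%:E)%E.
    by apply: eq_integral => y /set_mem/cM ->.
  by rewrite (nnmeas_intZ mu mC nomega (powR_ge0 _ _)).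
rewrite IO IV; apply: (@le_trans _ _
  ((M K x `^ q)%:E * (A * V `^ s)%:E)%E).
  by apply: lee_wpmul2l; [rewrite lee_fin powR_ge0|exact: omega_test].
have xN : M K x `^ p * V <= N.
  rewrite -lee_fin -IV; apply: le_trans st.
  exact: (nnmeas_int_sub mu mC measurableT nMV).
have x0 : 0 <= M K x `^ p * V by rewrite mulr_ge0 ?powR_ge0.
rewrite -!EFinM lee_fin mulrCA -mulrA ler_wpM2l//.
have -> : M K x `^ q * V `^ s = (M K x `^ p * V) `^ s.
  by rewrite powRM ?powR_ge0// -powRrM /s mulrCA divff ?gt_eqF// mulr1.
rewrite -(mulr_powRB1 x0 s0) mulrC ler_wpM2r//.
exact: ge0_ler_powR.
Qed.

End multilinear.

(** * Cubes, doubling and the grids of the one third trick *)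

Section boxes.
Context (R : realType) (d : nat).
Local Notation T := (d.-tuple R).
Local Notation mu := (lebesgue_tuple R d).
Implicit Types (a x y : T) (l : R).

Definition hcube a l : set T :=
  [set x | forall i, tnth a i <= tnth x i < tnth a i + l].

Lemma measurable_box (A : 'I_d -> set R) : (forall i, measurable (A i)) ->
  measurable [set x : T | forall i, A i (tnth x i)].
Proof.
move=> mA; rewrite (_ : [set x | _] = \bigcap_(i in [set: 'I_d])
   ((fun x : d.-tuple R => tnth x i) @^-1` A i)); last first.
  by apply/seteqP; split=> x /= Ax i; [move=> _|]; exact: Ax.
apply: fin_bigcap_measurable => // i _.
by rewrite -[X in measurable X]setTI; exact: measurable_tnth.
Qed.

Lemma cubeE a l :
  cube a l = [set x | forall i, `[tnth a i, tnth a i + l]%classic (tnth x i)].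
Proof. by apply/seteqP; split=> x /= ax i; have := ax i; rewrite in_itv. Qed.

Lemma hcubeE a l :
  hcube a l = [set x | forall i, `[tnth a i, tnth a i + l[%classic (tnth x i)].
Proof. by apply/seteqP; split=> x /= ax i; have := ax i; rewrite in_itv. Qed.

Lemma measurable_cube a l : measurable (cube a l).
Proof.
rewrite cubeE; apply: (@measurable_box (fun i => `[tnth a i, tnth a i + l]%classic)).
by move=> i; exact: measurable_itv.
Qed.

Lemma measurable_hcube a l : measurable (hcube a l).
Proof.
rewrite hcubeE; apply: (@measurable_box (fun i => `[tnth a i, tnth a i + l[%classic)).
by move=> i; exact: measurable_itv.
Qed.

Lemma mu_cube a l : 0 < l -> mu (cube a l) = (l ^+ d)%:E.
Proof.
move=> l0; rewrite cubeE (@lebesgue_tuple_box _ _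
  (fun i => `[tnth a i, tnth a i + l]%classic))//.
under eq_bigr => i _.
  rewrite lebesgue_measure_itv/= lte_fin ltrDl l0 -EFinB addrAC subrr add0r.
  over.
by rewrite prodEFin big_const_ord iter_mulr mulr1.
Qed.

Lemma mu_hcube a l : 0 < l -> mu (hcube a l) = (l ^+ d)%:E.
Proof.
move=> l0; rewrite hcubeE (@lebesgue_tuple_box _ _
  (fun i => `[tnth a i, tnth a i + l[%classic))//.
under eq_bigr => i _.
  rewrite lebesgue_measure_itv/= lte_fin ltrDl l0 -EFinB addrAC subrr add0r.
  over.
by rewrite prodEFin big_const_ord iter_mulr mulr1.
Qed.

Lemma hcube_sub a l : hcube a l `<=` cube a l.
Proof. by move=> x ax i; have /andP[-> /ltW->] := ax i. Qed.

(** Cells are half-open but the testing and doubling conditions speak of closed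
    cubes; faces are null sets because both cubes have the same volume. *)
Lemma integral_cube_hcube a l (h : T -> R) : 0 < l -> nnmeas h ->
  (\int[mu]_(x in cube a l) (h x)%:E = \int[mu]_(x in hcube a l) (h x)%:E)%E.
Proof.
move=> l0 nh; rewrite (ge0_negligible_integral (N := cube a l `\` hcube a l)).
- by rewrite setDD setIidr//; exact: hcube_sub.
- by apply: measurableD; [exact: measurable_cube|exact: measurable_hcube].
- exact: measurable_cube.
- exact: nnmeas_EFin.
- by move=> x _; rewrite lee_fin nh.2.
have foo : (mu (cube a l) < +oo)%E by rewrite (mu_cube a l0) ltry.
have mD := measureD (measurable_cube a l) (measurable_hcube a l) foo.
apply: (etrans mD); rewrite setIidr; last exact: hcube_sub.
apply: (etrans (congr2 (fun s t => s - t)%E (mu_cube a l0) (mu_hcube a l0))).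
by rewrite subee.
Qed.

Lemma cube_subP a l a' l' : 0 < l -> cube a l `<=` cube a' l' <->
  forall i, tnth a' i <= tnth a i /\ tnth a i + l <= tnth a' i + l'.
Proof.
move=> l0; split=> [sub i|h x ax i]; last first.
  have [h1 h2] := h i; have /andP[x1 x2] := ax i.
  by rewrite (le_trans h1 x1) (le_trans x2 h2).
split.
  have /sub/(_ i)/andP[]// : cube a l a.
  by move=> j; rewrite lexx lerDl ltW.
have /sub/(_ i) : cube a l [tuple tnth a i + l | i < d].
  by move=> j; rewrite tnth_mktuple lexx lerDl ltW.
by rewrite tnth_mktuple => /andP[].
Qed.

(** Between two nested cubes one finds an intermediate cube of half the side of
    the larger one, clamped so as to contain the smaller one. *)
Lemma doubling_iter (sigma : T -> R) (C : R) : (0 < d)%N -> 1 < C ->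
  (forall a l, 0 <= wmeas sigma (cube a l))%E ->
  (forall a l a' l', 0 < l -> 0 < l' -> cube a l `<=` cube a' l' ->
      l' <= 2 * l ->
      (wmeas sigma (cube a' l') <= C%:E * wmeas sigma (cube a l))%E) ->
  forall m a l a' l', 0 < l -> 0 < l' -> cube a l `<=` cube a' l' ->
      l' <= 2 ^+ m.+1 * l ->
      (wmeas sigma (cube a' l') <= (C ^+ m.+1)%:E * wmeas sigma (cube a l))%E.
Proof.
move=> d0 C1 s0 db; elim=> [|m IH] a l a' l' l0 l'0 sub hl; first exact: db.
have /(cube_subP _ _ _ l0) sub' := sub.
have ll' : l <= l' by have [h1 h2] := sub' (Ordinal d0); lra.
pose l1 := Num.max (l' / 2) l.
have l1l : l <= l1 by rewrite le_max lexx orbT.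
have l1l' : l1 <= l' by rewrite ge_max ll' andbT; lra.
have l'l1 : l' / 2 <= l1 by rewrite le_max lexx.
have l1m : l1 <= 2 ^+ m.+1 * l.
  rewrite ge_max; apply/andP; split; first by move: hl; rewrite exprS; lra.
  by rewrite ler_peMl ?(ltW l0)// exprn_ege1// ler1n.
have l10 : 0 < l1 by exact: lt_le_trans l1l.
pose a1 := [tuple Num.max (tnth a' i) (tnth a i + l - l1) | i < d].
have s1 : cube a l `<=` cube a1 l1.
  apply/(cube_subP _ _ _ l0) => i; rewrite tnth_mktuple; have [h1 h2] := sub' i.
  split; first by rewrite ge_max h1; lra.
  by rewrite -lerBlDr le_max lexx orbT.
have s2 : cube a1 l1 `<=` cube a' l'.
  apply/(cube_subP _ _ _ l10) => i; rewrite tnth_mktuple.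
  have [h1 h2] := sub' i.
  split; first by rewrite le_max lexx.
  by rewrite -lerBrDr ge_max; apply/andP; split; lra.
apply: (le_trans (db _ _ _ _ l10 l'0 s2 _)); first by lra.
rewrite exprS EFinM -muleA; apply: lee_wpmul2l.
  by rewrite lee_fin (le_trans ler01)// ltW.
exact: IH.
Qed.

End boxes.

Section grids.
Context (R : realType) (d : nat).
Local Notation T := (d.-tuple R).
Implicit Types (x y : T) (s : R) (u : {ffun 'I_d -> 'I_3}).

(** [gidx s u x] is the position of [x] in the grid of half-open cubes of side
    [3 / s] translated by [u / s]. Replacing [s] by [4 * s] refines this grid
    because 4 is 1 modulo 3. *)
Definition gidx s u x : {ffun 'I_d -> int} :=
  [ffun i => Num.floor ((s * tnth x i - (u i)%:R) / 3)].

Lemma gidx_preimage s u (z : {ffun 'I_d -> int}) : 0 < s ->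
  gidx s u @^-1` [set z] =
  hcube [tuple ((u i)%:R + 3 * (z i)%:~R) / s | i < d] (3 / s).
Proof.
move=> s0.
have key x i : (Num.floor ((s * tnth x i - (u i)%:R) / 3) == z i) =
    (((u i)%:R + 3 * (z i)%:~R) / s <= tnth x i <
     ((u i)%:R + 3 * (z i)%:~R) / s + 3 / s).
  rewrite floor_eq ler_pdivrMr// -mulrDl ltr_pdivlMr// ler_pdivlMr//.
  rewrite ltr_pdivrMr// intrD mulr1z; set t := tnth x i * s.
  by rewrite [s * _]mulrC -/t; congr (_ && _); apply/idP/idP => h; lra.
apply/seteqP; split=> [x /= xz i|x xz /=].
  by rewrite tnth_mktuple -key -xz ffunE.
apply/ffunP => i; rewrite ffunE; apply/eqP; rewrite key.
by have := xz i; rewrite tnth_mktuple.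
Qed.

Lemma gidx_refine s u x y :
  gidx (4 * s) u x = gidx (4 * s) u y -> gidx s u x = gidx s u y.
Proof.
have half x' y' i : gidx (4 * s) u x' = gidx (4 * s) u y' ->
    Num.floor ((s * tnth x' i - (u i)%:R) / 3) <=
    Num.floor ((s * tnth y' i - (u i)%:R) / 3).
  move=> /ffunP/(_ i); rewrite !ffunE.
  set v : R := (u i)%:R.
  have e t : (4 * s * t - v) / 3 = 4 * ((s * t - v) / 3) + (u i : int)%:~R.
    by rewrite (_ : (u i : int)%:~R = v)//; lra.
  rewrite !e !floorDrz ?intr_int//; try exact: intr_int.
  rewrite !intrKfloor => /addIr h.
  set z := Num.floor _; have z1 : z%:~R <= (s * tnth x' i - v) / 3.
    by have /andP[] := floor_itv ((s * tnth x' i - v) / 3).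
  have z2 : z * 4 <= Num.floor (4 * ((s * tnth x' i - v) / 3)).
    by rewrite floor_ge_int intrM; lra.
  (* by [h] the two points have the same integer part after multiplication
     by 4 *)
  rewrite floor_ge_int -(ler_pM2l (_ : 0 < 4 :> R))//.
  apply: le_trans (floor_le_tmp _); rewrite -h.
  by move: z2; rewrite -(ler_int R) intrM; lra.
move=> h; apply/ffunP => i; rewrite !ffunE; apply/eqP; rewrite eq_le.
by rewrite !half.
Qed.

(** One third trick: the cells of the [3 ^ d] grids are exactly the blocks made
    of three adjacent intervals of length [1 / s] in each coordinate. *)
Lemma cube_in_grid s a l x : 0 < s -> s * l <= 1 -> cube a l x ->
  exists u, forall y, cube a l y -> gidx s u y = gidx s u x.
Proof.
move=> s0 sl ax; pose m i := Num.floor (s * tnth x i) - 1.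
pose u : {ffun 'I_d -> 'I_3} := [ffun i => inord `|(m i %% 3)%Z|%N].
have uE i : (u i)%:R = (m i)%:~R - 3 * (m i %/ 3)%Z%:~R :> R.
  rewrite ffunE inordK; last first.
    by rewrite -ltz_nat gez0_abs ?modz_ge0//; exact: ltz_mod.
  rewrite {2}(divz_eq (m i) 3) intrD intrM mulrC addrAC subrr add0r.
  by rewrite natr_absz ger0_norm ?modz_ge0.
(* [m i] is the index of the left neighbour of the interval of length [1 / s]
   that contains [x], so the triple starting at [m i] contains the whole cube. *)
exists u; suff fE y i : cube a l y ->
    Num.floor ((s * tnth y i - (u i)%:R) / 3) = (m i %/ 3)%Z.
  by move=> y ay; apply/ffunP => i; rewrite [LHS]ffunE [RHS]ffunE !fE.
move=> ay; apply/eqP; rewrite floor_eq uE intrD mulr1z.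
have /andP[a1 a2] := ax i; have /andP[b1 b2] := ay i.
have /andP[] := floor_itv (s * tnth x i); rewrite intrD mulr1z.
rewrite /m intrB mulr1z; set f := (Num.floor _)%:~R => f1 f2.
set z : R := (_ %/ _)%Z%:~R.
have h1 : s * tnth y i <= s * tnth x i + s * l.
  by rewrite -mulrDr ler_pM2l//; lra.
have h2 : s * tnth x i <= s * tnth y i + s * l.
  by rewrite -mulrDr ler_pM2l//; lra.
move: (s * tnth y i) (s * tnth x i) (s * l) sl f1 f2 h1 h2 => Y X L *.
by apply/andP; split; lra.
Qed.

End grids.

(** * Domination of averages over cubes by the grid maximal functions *)

Section grid_family.
Context (R : realType) (d : nat).
Local Notation T := (d.-tuple R).
Local Notation mu := (lebesgue_tuple R d).
Implicit Types (N j : nat) (u : {ffun 'I_d -> 'I_3}).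

(** The scales 4^-N, ..., 4^N are indexed from [0] to [N + N], so that one tower
    of partitions indexed by the natural numbers covers a symmetric range of
    scales. *)
Definition scale N j : R := 4 ^+ j / 4 ^+ N.

Lemma scale_gt0 N j : 0 < scale N j.
Proof. by rewrite divr_gt0 ?exprn_gt0. Qed.

Lemma scaleS N j : scale N j.+1 = 4 * scale N j.
Proof. by rewrite /scale exprS mulrA. Qed.

Lemma scaleSS N j : scale N.+1 j.+1 = scale N j.
Proof.
by rewrite /scale !exprS invfM mulrACA divff ?mul1r.
Qed.

Lemma scale_exists (l : R) : 0 < l ->
  exists N j, [/\ (j <= N + N)%N, scale N j * l <= 1 & 1 < 4 * scale N j * l].
Proof.
move=> l0; pose N := Num.bound (l + l^-1).
have hN : l + l^-1 < 4 ^+ N.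
  apply: (@lt_trans _ _ N%:R).
    by apply: archi_boundP; rewrite addr_ge0 ?invr_ge0 ?(ltW l0).
  by rewrite -natrX ltr_nat ltn_expl.
have l'0 : 0 < l^-1 by rewrite invr_gt0.
have N0 : 0 < 4 ^+ N :> R by rewrite exprn_gt0.
have s0 : scale N 0 * l <= 1.
  rewrite /scale expr0 mul1r mulrC ler_pdivrMr// mul1r; lra.
have s2 : 1 < scale N (N + N) * l.
  rewrite /scale exprD mulfK ?gt_eqF// -ltr_pdivrMr// div1r; lra.
have step k : 1 < scale N k * l ->
    exists j, [/\ (j < k)%N, scale N j * l <= 1 & 1 < 4 * scale N j * l].
  elim: k => [|k IH] hk; first by move: hk; rewrite ltNge s0.
  have [sk|/IH[j [jk j1 j2]]] := leP (scale N k * l) 1.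
    by exists k; split => //; rewrite -scaleS.
  by exists j; split => //; exact: ltnW.
have [j [jk j1 j2]] := step _ s2.
by exists N, j; split => //; exact: ltnW.
Qed.

Definition grid N u j : T -> {ffun 'I_d -> int} := gidx (scale N j) u.

Lemma grid_nested N u : nested_partitions (grid N u).
Proof.
split=> [k z|k x y]; last by rewrite /grid scaleS; exact: gidx_refine.
by rewrite /grid gidx_preimage ?scale_gt0//; exact: measurable_hcube.
Qed.

Lemma grid_cell N u j x :
  exists b, cell (grid N u) j x = hcube b (3 / scale N j).
Proof.
eexists; apply: etrans (gidx_preimage u (gidx (scale N j) u x) (scale_gt0 N j)).
by [].
Qed.

Lemma grid_cellSS N u j x : cell (grid N.+1 u) j.+1 x = cell (grid N u) j x.
Proof. by rewrite /cell /grid scaleSS. Qed.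

End grid_family.

Section domination.
Context (R : realType) (d n : nat) (d0 : (0 < d)%N).
Local Notation T := (d.-tuple R).
Local Notation mu := (lebesgue_tuple R d).
Variables (w : 'I_n -> T -> R).
Hypothesis nw : forall i, nnmeas (w i).
Hypothesis w_gt0 : forall i x, 0 < w i x.
Hypothesis w_cube : forall i a l, 0 < l ->
  (\int[mu]_(y in cube a l) (w i y)%:E < +oo)%E.

Lemma int_cube_gt0 i a l : 0 < l ->
  (0 < \int[mu]_(y in cube a l) (w i y)%:E)%E.
Proof.
move=> l0; apply: integral_gt0.
- exact: measurable_cube.
- exact: nnmeas_EFin.
- by move=> x _; rewrite lte_fin.
- have muQ : (0 < mu (cube a l))%E by rewrite mu_cube// lte_fin exprn_gt0.
  exact: muQ.
Qed.

Lemma w_grid_cell N u i k x :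
  (0 < \int[mu]_(y in cell (grid N u) k x) (w i y)%:E < +oo)%E.
Proof.
have [b ->] := grid_cell N u k x.
have s0 : 0 < 3 / scale R N k by rewrite divr_gt0 ?scale_gt0.
by rewrite -integral_cube_hcube// int_cube_gt0// w_cube.
Qed.

Definition grid_max (f : 'I_n -> T -> R) N u : T -> R :=
  runmax (mcavg mu (grid N u) w f) (N + N).

(** A sum over the [3 ^ d] grids dominates the maximum over them and is linear
    under the integral. *)
Definition grid_sum (f : 'I_n -> T -> R) (q : R) N x : R :=
  \sum_(u : {ffun 'I_d -> 'I_3}) grid_max f N u x `^ q.

Section with_functions.
Variable f : 'I_n -> T -> R.
Hypothesis nf : forall i, nnmeas (f i).
Hypothesis fw_cube : forall i a l, 0 < l ->
  (\int[mu]_(y in cube a l) (f i y * w i y)%:E < +oo)%E.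

Lemma nnmeas_grid_max N u : nnmeas (grid_max f N u).
Proof.
by apply: nnmeas_runmax_mcavg => //; exact: grid_nested.
Qed.

(** Passing from [N] to [N.+1] only shifts the levels by one, because [scale] only
    depends on the difference of its arguments. *)
Lemma grid_max_nd N u x : grid_max f N u x <= grid_max f N.+1 u x.
Proof.
apply: runmax_le => k kN.
have -> : mcavg mu (grid N u) w f k x = mcavg mu (grid N.+1 u) w f k.+1 x.
  by apply: eq_bigr => i _; rewrite /cavg grid_cellSS.
by apply: (le_runmax (mcavg mu (grid N.+1 u) w f)); rewrite addSn addnS !ltnS leqW.
Qed.

Lemma nnmeas_grid_sum q N : nnmeas (grid_sum f q N).
Proof. by apply: nnmeas_sum => u; apply: nnmeas_powR; exact: nnmeas_grid_max. Qed.

Lemma grid_sum_nd q x : 0 <= q -> nondecreasing_seq (grid_sum f q ^~ x).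
Proof.
move=> q0; apply/nondecreasing_seqP => N; apply: ler_sum => u _.
apply: ge0_ler_powR => //; rewrite ?nnegrE ?(nnmeas_grid_max _ _).2//.
exact: grid_max_nd.
Qed.

Variable C : 'I_n -> R.
Hypothesis C1 : forall i, 1 < C i.
Hypothesis w_doubling : forall i a l a' l', 0 < l -> 0 < l' ->
  cube a l `<=` cube a' l' -> l' <= 2 * l ->
  (wmeas (w i) (cube a' l') <= (C i)%:E * wmeas (w i) (cube a l))%E.

(** A cube lies in a grid cell of side less than [12 * l], hence at most
    [2 ^+ 4 * l]: four doublings compare the two averages. *)
Lemma cube_average_le q a l x : 0 <= q -> 0 < l -> cube a l x ->
  exists N, (\prod_(i < n)
      (fine (\int[mu]_(y in cube a l) (f i y * w i y)%:E) /
       fine (\int[mu]_(y in cube a l) (w i y)%:E))) `^ q <=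
    (\prod_(i < n) C i ^+ 4) `^ q * grid_sum f q N x.
Proof.
move=> q0 l0 ax; have [N [j [jN s1 s2]]] := scale_exists l0.
have [u cu] := cube_in_grid (scale_gt0 R N j) s1 ax.
exists N.
have [b Pb] := grid_cell N u j x.
have sub : cube a l `<=` hcube b (3 / scale R N j).
  by rewrite -Pb => y /cu.
have t0 : 0 < 3 / scale R N j by rewrite divr_gt0 ?scale_gt0.
have t16 : 3 / scale R N j <= 2 ^+ 4 * l.
  rewrite ler_pdivrMr ?scale_gt0// -mulrA [l * _]mulrC.
  move: s2; rewrite -mulrA; set z := scale _ _ _ * l => s2.
  by have -> : 2 ^+ 4 = 16 :> R; [rewrite -natrX|lra].
have fw i : nnmeas (fun y => f i y * w i y) by exact: nnmeasM.
have mQ := measurable_cube a l.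
have mP := measurable_hcube b (3 / scale R N j).
have avg i : fine (\int[mu]_(y in cube a l) (f i y * w i y)%:E) /
       fine (\int[mu]_(y in cube a l) (w i y)%:E) <=
    C i ^+ 4 * cavg mu (grid N u) (w i) (f i) j x.
  rewrite /cavg Pb -!(integral_cube_hcube b t0)//.
  have fint b' l' : 0 < l' ->
      (\int[mu]_(y in cube b' l') (w i y)%:E)%E \is a fin_num.
    by move=> l'0; rewrite ge0_fin_numE ?w_cube//; exact: nnmeas_int_ge0.
  have finf b' l' : 0 < l' ->
      (\int[mu]_(y in cube b' l') (f i y * w i y)%:E)%E \is a fin_num.
    by move=> l'0; rewrite ge0_fin_numE ?fw_cube//; exact: nnmeas_int_ge0.
  have f0 b' l' : 0 < l' ->
      0 < fine (\int[mu]_(y in cube b' l') (w i y)%:E)%E.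
    by move=> l'0; rewrite fine_gt0// int_cube_gt0// w_cube.
  have sub' : cube a l `<=` cube b (3 / scale R N j).
    exact: subset_trans sub (@hcube_sub _ _ _ _).
  have le1 : fine (\int[mu]_(y in cube a l) (f i y * w i y)%:E) <=
      fine (\int[mu]_(y in cube b (3 / scale R N j)) (f i y * w i y)%:E).
    apply: fine_le; [exact: finf|exact: finf|].
    by apply: nnmeas_int_sub => //; exact: measurable_cube.
  have le2 : fine (\int[mu]_(y in cube b (3 / scale R N j)) (w i y)%:E) <=
      C i ^+ 4 * fine (\int[mu]_(y in cube a l) (w i y)%:E).
    rewrite -lee_fin EFinM !fineK; try exact: fint.
    apply: (doubling_iter d0 (C1 i) _ (@w_doubling i)) => //.
    by move=> a' l'; exact: nnmeas_int_ge0.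
  rewrite ler_pdivrMr; last exact: f0.
  rewrite mulrA [leRHS]mulrAC ler_pdivlMr; last exact: f0.
  rewrite -[leRHS]mulrA [leRHS]mulrCA ler_pM//; last exact/ltW/f0.
  by apply: fine_ge0; exact: nnmeas_int_ge0.
have D0 : 0 <= \prod_(i < n) C i ^+ 4.
  by apply: prodr_ge0 => i _; rewrite exprn_ge0// (le_trans ler01)// ltW.
have hprod : \prod_(i < n)
      (fine (\int[mu]_(y in cube a l) (f i y * w i y)%:E) /
       fine (\int[mu]_(y in cube a l) (w i y)%:E)) <=
    \prod_(i < n) C i ^+ 4 * grid_max f N u x.
  apply: (@le_trans _ _ (\prod_(i < n) C i ^+ 4 *
      mcavg mu (grid N u) w f j x)); last first.
    by apply: ler_wpM2l => //; exact: (le_runmax (mcavg mu (grid N u) w f)).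
  rewrite -big_split/=; apply: ler_prod => i _; rewrite avg andbT.
  by rewrite divr_ge0// fine_ge0//; exact: nnmeas_int_ge0.
apply: (@le_trans _ _ ((\prod_(i < n) C i ^+ 4 * grid_max f N u x) `^ q)).
  apply: ge0_ler_powR => //; rewrite ?nnegrE.
    apply: prodr_ge0 => i _.
    by rewrite divr_ge0// fine_ge0//; exact: nnmeas_int_ge0.
  by rewrite mulr_ge0// (nnmeas_grid_max _ _).2.
rewrite powRM ?(nnmeas_grid_max _ _).2// ler_wpM2l ?powR_ge0//.
by rewrite /grid_sum (bigD1 u)//= lerDl sumr_ge0// => v _; exact: powR_ge0.
Qed.

End with_functions.
End domination.

(** * Strong type bound for all grids and all scales *)

Section strong_type_grids.
Context (R : realType) (d n : nat).
Local Notation T := (d.-tuple R).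
Local Notation mu := (lebesgue_tuple R d).
Variables (w f : 'I_n -> T -> R) (e B : 'I_n -> R) (p q : R).
Hypothesis nw : forall i, nnmeas (w i).
Hypothesis w_gt0 : forall i x, 0 < w i x.
Hypothesis w_cube : forall i a l, 0 < l ->
  (\int[mu]_(y in cube a l) (w i y)%:E < +oo)%E.
Hypothesis nf : forall i, nnmeas (f i).
Hypothesis e1 : forall i, 1 < e i.
Hypothesis p0 : 0 < p.
Hypothesis pe : \sum_(i < n) p / e i = 1.
Hypothesis pq : p <= q.
Hypothesis fB : forall i, (\int[mu]_y (f i y `^ e i * w i y)%:E <= (B i)%:E)%E.
Variables (omega : T -> R) (A : R).
Hypothesis nomega : nnmeas omega.
Hypothesis A0 : 0 <= A.
Hypothesis omega_test : forall a l, 0 < l ->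
  (\int[mu]_(y in cube a l) (omega y)%:E <= (A *
   fine (\int[mu]_(y in cube a l) (geometric_weight w e p y)%:E) `^ (q / p))%:E)%E.

Local Notation bound := (A * strong_const e B `^ (q / p)).

Lemma grid_max_strong N u :
  (\int[mu]_y (grid_max w f N u y `^ q * omega y)%:E <= bound%:E)%E.
Proof.
rewrite /grid_max.
have wc i k x := w_grid_cell nw w_gt0 w_cube N u i k x.
apply: (maximal_testing (grid_nested R N u) nw wc nf e1 p0 pe pq fB nomega A0).
move=> x; have [b Pb] := grid_cell N u (N + N) x.
have t0 : 0 < 3 / scale R N (N + N) by rewrite divr_gt0 ?scale_gt0.
have nV : nnmeas (geometric_weight w e p) by exact: nnmeas_geometric_weight.
have := omega_test b t0.
by rewrite (integral_cube_hcube b t0 nomega) (integral_cube_hcube b t0 nV) -Pb.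
Qed.

Lemma grid_sum_strong N :
  (\int[mu]_y (grid_sum w f q N y * omega y)%:E <=
   (bound *+ #|{ffun 'I_d -> 'I_3}|)%:E)%E.
Proof.
have nm u : nnmeas (fun y => grid_max w f N u y `^ q * omega y).
  by apply: nnmeasM => //; apply: nnmeas_powR; exact: nnmeas_grid_max.
under eq_integral do rewrite /grid_sum mulr_suml.
rewrite (nnmeas_int_sum mu _ measurableT nm).
have -> : bound *+ #|{ffun 'I_d -> 'I_3}| =
    \sum_(u : {ffun 'I_d -> 'I_3}) bound by rewrite sumr_const.
by rewrite -sumEFin; apply: lee_sum => u _; exact: grid_max_strong.
Qed.

(** [G] is the limit over all scales; it is measurable and integrable as a
    monotone limit, and bounds every truncated sum. *)
Theorem grid_majorant : exists G : T -> \bar R,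
  [/\ measurable_fun setT G, (forall x, 0 <= G x)%E,
      (forall N x, (grid_sum w f q N x * omega x)%:E <= G x)%E &
      (\int[mu]_y G y <= (bound *+ #|{ffun 'I_d -> 'I_3}|)%:E)%E].
Proof.
have q0 : 0 <= q by rewrite (le_trans _ pq)// ltW.
pose h N x := (grid_sum w f q N x * omega x)%:E.
have nh N : nnmeas (fun x => grid_sum w f q N x * omega x).
  by apply: nnmeasM => //; exact: nnmeas_grid_sum.
have mh N : measurable_fun setT (h N) by exact: nnmeas_EFin.
have h0 N x : (0 <= h N x)%E by rewrite lee_fin (nh N).2.
have ndh x : nondecreasing_seq (h ^~ x).
  move=> N M NM; rewrite lee_fin ler_wpM2r ?nomega.2//.
  exact: (@grid_sum_nd _ _ _ _ nw _ nf).
have cvgh x : cvgn (h ^~ x) by exact: ereal_nondecreasing_is_cvgn.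
have hG N x : (h N x <= limn (h ^~ x))%E.
  apply: lime_ge; first exact: cvgh.
  by near=> M; apply: ndh; near: M; exact: nbhs_infty_ge.
exists (fun x => limn (h ^~ x)); split => //.
- by apply: (emeasurable_fun_cvg h) => // x _; exact: cvgh.
- by move=> x; exact: le_trans (h0 0%N x) (hG 0%N x).
rewrite (monotone_convergence mu measurableT mh); last 2 first.
- by move=> N x _.
- by move=> x _; exact: ndh.
apply: lime_le.
  apply: ereal_nondecreasing_is_cvgn => N M NM.
  apply: ge0_le_integral => // x _; exact: ndh.
by apply: nearW => N; exact: grid_sum_strong.
Unshelve. all: by end_near. Qed.

End strong_type_grids.

(** * Growth functions comparable to powers *)

Section power_like.
Context (R : realType).
Implicit Types (f g Phi : R -> R) (p q : R).

(** Two-sided comparison with a power; a single constant keeps products and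
    inverses short. *)
Definition power_like p f := exists2 k, 0 < k &
  forall t, 0 < t -> k^-1 * t `^ p <= f t <= k * t `^ p.

Lemma powR_invr (t r : R) : 0 < t -> t^-1 `^ r = (t `^ r)^-1.
Proof.
by move=> t0; rewrite -(powR_inv1 (ltW t0)) -powRN -!powRrM mulN1r.
Qed.

Lemma power_like_bounds p f a b : 0 < a -> 0 < b ->
  (forall t, 0 < t -> a * t `^ p <= f t <= b * t `^ p) -> power_like p f.
Proof.
move=> a0 b0 h; exists (a^-1 + b); first by rewrite addr_gt0 ?invr_gt0.
have a'0 : 0 < a^-1 by rewrite invr_gt0.
move=> t t0; have /andP[h1 h2] := h _ t0; apply/andP; split.
  rewrite (le_trans _ h1)// ler_wpM2r ?powR_ge0// -[leRHS]invrK.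
  by rewrite lef_pV2 ?posrE ?addr_gt0 ?lerDl// ltW.
by rewrite (le_trans h2)// ler_wpM2r ?powR_ge0// lerDr ltW.
Qed.

Lemma power_like_gt0 p f t : power_like p f -> 0 < t -> 0 < f t.
Proof.
move=> [k k0 h] t0; have /andP[h1 _] := h _ t0.
by apply: lt_le_trans h1; rewrite mulr_gt0 ?invr_gt0 ?powR_gt0.
Qed.

Lemma eq_power_like p f g : (forall t, 0 < t -> f t = g t) ->
  power_like p f -> power_like p g.
Proof. by move=> fg [k k0 h]; exists k => // t t0; rewrite -fg// h. Qed.

Lemma power_like_cst1 : power_like 0 (fun=> 1).
Proof. by exists 1 => // t t0; rewrite powRr0 invr1 mulr1 lexx. Qed.

Lemma power_likeM p q f g : power_like p f -> power_like q g ->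
  power_like (p + q) (fun t => f t * g t).
Proof.
move=> [k k0 hf] [l l0 hg]; exists (k * l); first exact: mulr_gt0.
move=> t t0; have /andP[f1 f2] := hf _ t0; have /andP[g1 g2] := hg _ t0.
have e1 : (k * l)^-1 * t `^ (p + q) = (k^-1 * t `^ p) * (l^-1 * t `^ q).
  by rewrite powRD ?(gt_eqF t0) ?implybT// invfM mulrACA.
have e2 : k * l * t `^ (p + q) = (k * t `^ p) * (l * t `^ q).
  by rewrite powRD ?(gt_eqF t0) ?implybT// mulrACA.
have f0 : 0 <= k^-1 * t `^ p by rewrite mulr_ge0 ?powR_ge0// invr_ge0 ltW.
have g0 : 0 <= l^-1 * t `^ q by rewrite mulr_ge0 ?powR_ge0// invr_ge0 ltW.
rewrite e1 e2; apply/andP; split; apply: ler_pM => //.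
  exact: le_trans f1.
exact: le_trans g1.
Qed.

Lemma power_like_prod n (p : 'I_n -> R) (f : 'I_n -> R -> R) :
  (forall i, power_like (p i) (f i)) ->
  power_like (\sum_(i < n) p i) (fun t => \prod_(i < n) f i t).
Proof.
elim: n p f => [|n IH] p f h.
  rewrite big_ord0; apply: eq_power_like power_like_cst1 => t _.
  by rewrite big_ord0.
rewrite big_ord_recl; apply: (@eq_power_like _
    (fun t => f ord0 t * \prod_(i < n) f (lift ord0 i) t)).
  by move=> t _; rewrite big_ord_recl.
by apply: power_likeM => //; exact: IH.
Qed.

Lemma power_like_comp p q f g : 0 <= p -> power_like p f -> power_like q g ->
  power_like (q * p) (f \o g).
Proof.
move=> p0 hf hg; have g0 t := @power_like_gt0 _ _ t hg.
have [k k0 {}hf] := hf; have [l l0 {}hg] := hg.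
apply: (@power_like_bounds _ _ (k^-1 * l^-1 `^ p) (k * l `^ p)).
- by rewrite mulr_gt0 ?invr_gt0// powR_gt0 ?invr_gt0.
- by rewrite mulr_gt0// powR_gt0.
move=> t t0; have /andP[f1 f2] := hf _ (g0 _ t0); have /andP[g1 g2] := hg _ t0.
have lk : 0 <= l^-1 by rewrite invr_ge0 ltW.
apply/andP; split.
  rewrite -mulrA powRrM -powRM ?powR_ge0// (le_trans _ f1)//.
  rewrite ler_wpM2l ?invr_ge0 ?(ltW k0)// ge0_ler_powR ?nnegrE ?mulr_ge0 ?powR_ge0//.
  exact/ltW/g0.
rewrite -mulrA powRrM -powRM ?powR_ge0 ?(ltW l0)// (le_trans f2)//.
rewrite ler_wpM2l ?(ltW k0)// ge0_ler_powR ?nnegrE ?mulr_ge0 ?powR_ge0 ?(ltW l0)//.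
exact/ltW/g0.
Qed.

Lemma power_like_inv p f g : 0 < p -> power_like p f ->
  (forall y, 0 < y -> 0 < g y /\ f (g y) = y) -> power_like p^-1 g.
Proof.
move=> p0 [k k0 hf] hg.
have k'0 : 0 < k^-1 by rewrite invr_gt0.
have pi0 : 0 <= p^-1 by rewrite invr_ge0 ltW.
apply: (@power_like_bounds _ _ (k^-1 `^ p^-1) (k `^ p^-1)); rewrite ?powR_gt0//.
move=> y y0; have [x0 fx] := hg _ y0; set x := g y in x0 fx *.
have /andP[h1 h2] := hf _ x0; rewrite fx in h1 h2.
have xE : x = (x `^ p) `^ p^-1 by rewrite -powRrM divff ?gt_eqF// powRr1 ?ltW.
rewrite -!powRM ?(ltW k'0) ?(ltW k0) ?(ltW y0)//; apply/andP; split.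
  rewrite [leRHS]xE ge0_ler_powR ?nnegrE ?powR_ge0 ?mulr_ge0 ?(ltW y0) ?(ltW k'0)//.
  by rewrite mulrC ler_pdivrMr// mulrC.
rewrite [leLHS]xE ge0_ler_powR ?nnegrE ?powR_ge0 ?mulr_ge0 ?(ltW y0) ?(ltW k0)//.
by rewrite -ler_pdivrMl.
Qed.

End power_like.

Section growth.
Context (R : realType).
Implicit Types (Phi : R -> R) (q : R).

Lemma RplusP (t : R) : Rplus t <-> 0 <= t.
Proof. by rewrite /Rplus /= in_itv/= andbT. Qed.

Lemma growth_function0 Phi : growth_function Phi -> Phi 0 = 0.
Proof.
move=> [Phi0 _ _ nd onto]; have [t t0 Pt] := onto 0 (lexx _).
have Pt0 : Phi 0 <= Phi t by exact: nd.
by apply/eqP; rewrite eq_le Phi0// andbT (le_trans Pt0)// Pt.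
Qed.

Lemma invRplusK Phi y : growth_function Phi -> 0 <= y ->
  0 <= invRplus Phi y /\ Phi (invRplus Phi y) = y.
Proof.
move=> [_ _ _ _ onto] y0; have [t t0 Pt] := onto y y0.
have yin : y \in [set Phi x | x in Rplus].
  by rewrite inE; exists t => //; exact/RplusP.
split; last exact: (pinvK (fun=> 0)).
have /RplusP// : Rplus (invRplus Phi y).
apply: (@surjpinv_image_sub _ _ (fun=> 0) Rplus [set y] Phi).
  by move=> _ ->; exists t => //; exact/RplusP.
by exists y.
Qed.

Lemma invRplus_gt0 Phi y : growth_function Phi -> 0 < y -> 0 < invRplus Phi y.
Proof.
move=> gf y0; have [x0 Px] := invRplusK gf (ltW y0).
rewrite lt_neqAle x0 andbT; apply/eqP => x00.
by move: Px y0; rewrite -x00 growth_function0// => <-; rewrite ltxx.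
Qed.

(** The bound [Phi (s / t) <= C * Phi s / t ^ q] with [s = 1] controls [Phi]
    near 0 from above, the upper type controls it at infinity; the upper type
    and submultiplicativity applied to 1 = t * (1 / t) give the opposite
    bounds. *)
Lemma classUtilde_power_like q Phi : 0 < q -> classUtilde_q q Phi ->
  power_like q Phi.
Proof.
move=> q0 [[gf [Cu Cu0 up] _ _] [Cd Cd0 dp] [Cs Cs0 sc]].
have [P0 _ _ nd onto] := gf.
have P1 : 0 < Phi 1.
  rewrite lt_neqAle P0// andbT; apply/eqP => P10.
  have [t t0 Pt] := onto 1 ler01.
  have : Phi t <= 0.
    have [t1|t1] := leP t 1; first by rewrite P10 nd.
    by have := up 1 t ltr01 (ltW t1); rewrite mul1r -P10 mulr0.
  by rewrite Pt ler10.
have inf1 (t : R) : 0 < t -> t <= 1 -> 1 <= t^-1 by move=> *; rewrite invf_ge1.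
have small_up t : 0 < t -> t <= 1 -> Phi t <= Cs * Phi 1 * t `^ q.
  move=> t0 t1; have := sc 1 t^-1 (lexx _) (inf1 _ t0 t1).
  by rewrite div1r invrK powR_invr// invrK.
have small_lo t : 0 < t -> t <= 1 -> Phi 1 / Cu * t `^ q <= Phi t.
  move=> t0 t1; have := up t t^-1 t0 (inf1 _ t0 t1).
  rewrite divff ?gt_eqF// powR_invr// mulrAC => h.
  rewrite mulrAC ler_pdivrMr// -ler_pdivlMr ?powR_gt0//.
  by rewrite mulrC mulrA (le_trans h)// mulrAC mulrC mulrA.
have big_up t : 1 <= t -> Phi t <= Cu * Phi 1 * t `^ q.
  by move=> t1; have := up 1 t ltr01 t1; rewrite mul1r mulrAC.
have big_lo t : 1 <= t -> (Cd * Cs)^-1 * t `^ q <= Phi t.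
  move=> t1; have t0 : 0 < t by exact: lt_le_trans t1.
  have ti0 : 0 < t^-1 by rewrite invr_gt0.
  have ti1 : t^-1 <= 1 by rewrite invf_le1.
  have h := dp t t^-1 t0 ti0; rewrite divff ?gt_eqF// in h.
  have h2 := small_up _ ti0 ti1.
  have : Phi 1 <= Cd * Phi t * (Cs * Phi 1 * t^-1 `^ q).
    by rewrite (le_trans h)// ler_wpM2l// mulr_ge0 ?P0 ?ltW.
  rewrite powR_invr// => h3.
  rewrite mulrC ler_pdivrMr ?mulr_gt0// -(ler_pM2r P1).
  have tq0 : 0 < t `^ q by rewrite powR_gt0.
  rewrite mulrC -ler_pdivlMr//; apply: (le_trans h3).
  by rewrite le_eqVlt; apply/orP; left; apply/eqP; ring.
pose a := Num.min (Phi 1 / Cu) (Cd * Cs)^-1.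
pose b := Num.max (Cs * Phi 1) (Cu * Phi 1).
apply: (@power_like_bounds _ _ _ a b).
- by rewrite lt_min divr_gt0//= invr_gt0 mulr_gt0.
- by rewrite lt_max mulr_gt0.
move=> t t0; have tq0 := powR_ge0 t q.
have [t1|/ltW t1] := leP t 1; apply/andP; split.
- by apply: le_trans (small_lo _ t0 t1); rewrite ler_wpM2r// ge_min lexx.
- by apply: (le_trans (small_up _ t0 t1)); rewrite ler_wpM2r// le_max lexx.
- by apply: le_trans (big_lo _ t1); rewrite ler_wpM2r// ge_min lexx orbT.
- by apply: (le_trans (big_up _ t1)); rewrite ler_wpM2r// le_max lexx orbT.
Qed.

End growth.

(** * The nabla-2 condition excludes linear growth *)

Section nabla2_exponent.
Context (R : realType).

Let measurable_invr (E : set R) : measurable E -> E `<=` [set x | 0 < x] ->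
  measurable_fun E (fun s : R => (s^-1)%:E).
Proof.
move=> mE E0; apply/measurable_EFinP.
apply: (@measurable_funS _ _ _ _ [set x : R | 0 < x]) => //.
  rewrite (_ : [set x | _] = `]0, +oo[%classic); first exact: measurable_itv.
  by apply/seteqP; split=> x /=; rewrite in_itv/= andbT.
rewrite (_ : [set x | _] = `]0, +oo[%classic); last first.
  by apply/seteqP; split=> x /=; rewrite in_itv/= andbT.
apply: open_continuous_measurable_fun; first exact: interval_open.
by move=> x; rewrite inE/= in_itv/= andbT => x0; apply: inv_continuous; rewrite gt_eqF.
Qed.

(** Each dyadic interval contributes at least one half. *)
Lemma integral_inv_ge (m : nat) :
  ((m%:R / 2)%:E <= \int[lebesgue_measure]_(s in `](2 ^- m)%R, (1 : R)%R[) (s^-1)%:E)%E.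
Proof.
have pos (a b : R) : 0 <= a -> `]a, b[%classic `<=` [set x : R | 0 < x].
  by move=> a0 x /=; rewrite in_itv/= => /andP[ax _]; exact: le_lt_trans ax.
have p2 k : 0 < (2 : R) ^- k by rewrite invr_gt0 exprn_gt0.
have nn (a b : R) x : 0 <= a -> `]a, b[%classic x -> (0 <= (x^-1)%:E)%E.
  by move=> a0 /(pos _ _ a0)/= x0; rewrite lee_fin invr_ge0 ltW.
elim: m => [|m IH].
  rewrite mul0r; apply: integral_ge0 => x; apply: nn; exact/ltW.
pose I1 : set R := `]2 ^- m.+1, 2 ^- m[%classic.
pose I2 : set R := `]2 ^- m, 1[%classic.
have half : (2 : R) ^- m.+1 = 2 ^- m / 2 by rewrite exprSr invfM.
have lt1 : (2 : R) ^- m.+1 < 2 ^- m by have := p2 m; rewrite half; lra.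
have le1 : (2 : R) ^- m <= 1 by rewrite invf_le1 ?exprn_gt0// exprn_ege1// ler1n.
have mI1 : measurable I1 by exact: measurable_itv.
have mI2 : measurable I2 by exact: measurable_itv.
have mI3 : measurable (`]2 ^- m.+1, (1 : R)[%classic : set R).
  exact: measurable_itv.
apply: (@le_trans _ _ (\int[lebesgue_measure]_(s in I1 `|` I2) (s^-1)%:E)%E);
    last first.
  apply: ge0_subset_integral => //; first exact: measurableU.
  - by apply: measurable_invr => //; apply: pos; exact/ltW.
  - by move=> x; apply: nn; exact/ltW.
  - move=> x []; rewrite /I1 /I2 /= !in_itv/= => /andP[x1 x2]; apply/andP; split=> //.
      exact: lt_le_trans le1.
    exact: lt_trans x1.
rewrite ge0_integral_setU//; last 3 first.
- apply: measurable_invr; first exact: measurableU.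
  by move=> x [] h; apply: pos h; exact/ltW.
- by move=> x [] h; apply: nn h; exact/ltW.
- apply/disj_setPS => x []; rewrite /I1 /I2 /= !in_itv/= => /andP[_ x2] /andP[x1 _].
  by have := lt_trans x1 x2; rewrite ltxx.
apply: (@le_trans _ _ ((1 / 2)%:E + (m%:R / 2)%:E)%E).
  by rewrite -EFinD lee_fin -addn1 natrD; lra.
apply: leeD => //.
apply: (@le_trans _ _ (\int[lebesgue_measure]_(s in I1) (2 ^+ m)%:E)%E).
  rewrite integral_cst//= lebesgue_measure_itv/= lte_fin lt1 -EFinB -EFinM.
  rewrite lee_fin half; have : (2 : R) ^+ m * 2 ^- m = 1 by rewrite divff.
  lra.
apply: ge0_le_integral => //.
- by apply: measurable_invr => //; apply: pos; exact/ltW.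
move=> x; rewrite /I1/= in_itv/= => /andP[x1 x2]; rewrite lee_fin.
by rewrite -[leLHS]invrK lef_pV2 ?posrE ?p2 ?ltW// (lt_trans _ x1)// p2.
Qed.

(** For [Phi] comparable to [t] the integral in the nabla-2 condition dominates
    the divergent integral of [1 / s] near 0. *)
Lemma nabla2_not_linear (Phi : R -> R) : power_like 1 Phi -> ~ nabla2 Phi.
Proof.
move=> [k k0 hk] [gf _ _ [C C0 hC]].
have [_ _ _ nd _] := gf.
have := hC 1 ltr01; rewrite divr1; set M := C * Phi 1 => hM.
have M0 : 0 <= M.
  have P1 : 0 < Phi 1 by apply: (@power_like_gt0 _ 1) => //; exists k.
  by rewrite /M mulr_ge0 ?(ltW C0)// ltW.
pose m := (Num.bound (2 * k * M)).
have hm : 2 * k * M < m%:R.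
  by apply: archi_boundP; apply: mulr_ge0 => //; rewrite mulr_ge0// ltW.
suff : (((k^-1) * (m%:R / 2))%:E <= M%:E)%E.
  rewrite lee_fin => h; move: hm; apply/negP; rewrite -leNgt.
  have <- : k * (k^-1 * (m%:R / 2)) * 2 = m%:R.
    by rewrite mulVKf ?gt_eqF// divfK.
  by rewrite -[2 * k * M]mulrA [2 * _]mulrC ler_pM2r// ler_pM2l.
apply: le_trans hM; rewrite EFinM.
pose E : set R := `]2 ^- m, 1[%classic.
have mE : measurable E by exact: measurable_itv.
have E0 : E `<=` [set x | 0 < x].
  move=> x; rewrite /E/= in_itv/= => /andP[x1 _]; apply: lt_trans x1.
  by rewrite invr_gt0 exprn_gt0.
apply: (@le_trans _ _ ((k^-1)%:E *
    \int[lebesgue_measure]_(s in E) (s^-1)%:E)%E).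
  by apply: lee_wpmul2l; [rewrite lee_fin invr_ge0 ltW|exact: integral_inv_ge].
rewrite -ge0_integralZl_EFin//; last 3 first.
- by move=> x /E0/= x0; rewrite lee_fin invr_ge0 ltW.
- exact: measurable_invr.
- by rewrite invr_ge0 ltW.
have sub : E `<=` `]0%R, 1[%classic.
  move=> x Ex; have /= x0 := E0 _ Ex; move: Ex; rewrite /E/= !in_itv/= x0.
  by case/andP.
rewrite integral_mkcond [leRHS]integral_mkcond.
apply: le_integral_ae => //.
- apply/(measurable_restrictT _ _).1 => //.
  by apply: measurable_funeM; exact: measurable_invr.
- move=> x _; apply: erestrict_ge0 => y /E0/= y0.
  by rewrite -EFinM lee_fin mulr_ge0 ?invr_ge0 ?ltW.
apply: aeW => x _; rewrite /patch; case: ifPn => [xE|_].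
  have Ex := set_mem xE; have x0 : 0 < x by exact: E0.
  rewrite ifT; last by rewrite inE; exact: sub.
  rewrite -EFinM lee_fin ler_pdivlMr ?exprn_gt0//.
  have /andP[h _] := hk x x0; rewrite (powRr1 (ltW x0)) in h.
  by rewrite expr2 mulrA divfK ?gt_eqF.
case: ifPn => // /set_mem/=; rewrite in_itv/= => /andP[x0 _].
have Px : 0 < Phi x by apply: (@power_like_gt0 _ 1) => //; exists k.
by rewrite lee_fin divr_ge0 ?exprn_ge0 ?(ltW x0) ?(ltW Px).
Qed.

Lemma classUtilde_nabla2_exponent (q : R) (Phi : R -> R) : 1 <= q ->
  classUtilde_q q Phi -> nabla2 Phi -> 1 < q.
Proof.
move=> q1 cq n2; rewrite lt_neqAle q1 andbT; apply/eqP => q1E.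
apply: (@nabla2_not_linear Phi) => //; rewrite q1E.
by apply: classUtilde_power_like => //; exact: lt_le_trans q1.
Qed.

End nabla2_exponent.

(** * Borel representatives of weights and functions *)

Section regularisation.
Context (R : realType) (d : nat).
Local Notation T := (d.-tuple R).
Local Notation mu := (lebesgue_tuple R d).
Implicit Types (sigma w : T -> R).

Lemma nnmeas_restrict_pos (g : T -> R) (c : R) : 0 <= c -> measurable_fun setT g ->
  nnmeas (fun x => if 0 < g x then g x else c).
Proof.
move=> c0 mg; split; last by move=> x; case: ifPn => // /ltW.
apply: measurable_fun_ifT => //.
- by apply: measurable_fun_ltr => //; exact: measurable_cst.
Qed.

Lemma compact_cube a l : compact [set \row_i tnth x i | x in @cube R d a l].
Proof.
rewrite (_ : [set _ | _ in _] =
  [set v : 'rV[R]_d | forall i, `[tnth a i, tnth a i + l]%classic (v ord0 i)]).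
  by apply: (rV_compact (A := fun i => `[tnth a i, tnth a i + l]%classic)) => i; exact: segment_compact.
apply/seteqP; split=> [_ [x ax <-] i|v av].
  by rewrite mxE/= in_itv/=; exact: ax.
exists [tuple v ord0 i | i < d].
  by move=> i; rewrite tnth_mktuple; have := av i; rewrite /= in_itv.
by apply/rowP => i; rewrite mxE tnth_mktuple.
Qed.

Lemma wmeas_ae sigma w E : measurable E -> nnmeas w ->
  {ae mu, forall x, sigma x = w x} ->
  wmeas sigma E = (\int[mu]_(x in E) (w x)%:E)%E.
Proof.
move=> mE nw sw; apply: integral_eq_ae => //.
- exact: nnmeas_EFin.
- by move=> x _; rewrite lee_fin nw.2.
- by apply: filterS sw => x ->.
Qed.

(** The representative is made positive everywhere, not only almost everywhere,
    so that its averages and powers need no exceptional set. *)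
Lemma weight_regular sigma : weight sigma -> exists w,
  [/\ nnmeas w, (forall x, 0 < w x), {ae mu, forall x, sigma x = w x} &
      forall a l, (\int[mu]_(x in cube a l) (w x)%:E < +oo)%E].
Proof.
move=> [[g mg sg] li s0]; pose w x := if 0 < g x then g x else 1.
have nw : nnmeas w by exact: nnmeas_restrict_pos.
have sw : {ae mu, forall x, sigma x = w x}.
  by apply: filterS2 sg s0 => x sgx s0x; rewrite /w -sgx// s0x.
exists w; split => //.
  by move=> x; rewrite /w; case: ifPn.
move=> a l; have lia := li _ (@compact_cube a l); apply: le_lt_trans lia.
apply: le_integral_ae; first exact: measurable_cube.
- exact: nnmeas_EFin.
- by move=> x _; rewrite lee_fin nw.2.
- by apply: filterS sw => x -> _; rewrite lee_fin ler_norm.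
Qed.

Lemma complex_measurable_normc (f : T -> R[i]) : complex_measurable f ->
  exists2 h, nnmeas h & {ae mu, forall x, Normc.normc (f x) = h x}.
Proof.
move=> [[g1 mg1 fg1] [g2 mg2 fg2]].
have h0 x : 0 <= g1 x ^+ 2 + g2 x ^+ 2 by rewrite addr_ge0 ?sqr_ge0.
exists (fun x => (g1 x ^+ 2 + g2 x ^+ 2) `^ 2^-1).
  apply: nnmeas_powR; split=> //.
  by apply: measurable_funD; exact: measurable_funX.
apply: filterS2 fg1 fg2 => x f1 f2; rewrite powR12_sqrt// -f1// -f2//.
by rewrite /Normc.normc; case: (f x).
Qed.

End regularisation.

(** * The modular of the maximal function *)

Section maximal_modular.
Context (R : realType) (d n : nat) (d0 : (0 < d)%N) (n0 : (0 < n)%N).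
Local Notation T := (d.-tuple R).
Local Notation mu := (lebesgue_tuple R d).
Variables (sigma w : 'I_n -> T -> R) (C : 'I_n -> R).
Hypothesis nw : forall i, nnmeas (w i).
Hypothesis w_gt0 : forall i x, 0 < w i x.
Hypothesis w_cube : forall i a l,
  (\int[mu]_(y in cube a l) (w i y)%:E < +oo)%E.
Hypothesis sigma_w : forall i, {ae mu, forall x, sigma i x = w i x}.
Hypothesis C1 : forall i, 1 < C i.
Hypothesis w_doubling : forall i a l a' l', 0 < l -> 0 < l' ->
  cube a l `<=` cube a' l' -> l' <= 2 * l ->
  (wmeas (w i) (cube a' l') <= (C i)%:E * wmeas (w i) (cube a l))%E.
Variables (f : 'I_n -> T -> R[i]) (g : 'I_n -> T -> R) (lam : 'I_n -> R).
Hypothesis ng : forall i, nnmeas (g i).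
Hypothesis lam0 : forall i, 0 < lam i.
Hypothesis f_g : forall i, {ae mu, forall x, Normc.normc (f i x) = lam i * g i x}.
Hypothesis gw_cube : forall i a l, 0 < l ->
  (\int[mu]_(y in cube a l) (g i y * w i y)%:E < +oo)%E.
Variable q : R.
Hypothesis q0 : 0 < q.

Let D := \prod_(i < n) C i ^+ 4.
Let L := \prod_(i < n) lam i.

Let D_ge0 : 0 <= D.
Proof. by apply: prodr_ge0 => i _; rewrite exprn_ge0// (le_trans ler01)// ltW. Qed.

Let L_ge0 : 0 <= L. Proof. by apply: prodr_ge0 => i _; exact: ltW. Qed.

(** Every factor is a finite real number, so the product of extended reals over
    one cube is a real product; [lam] is pulled out by homogeneity. *)
Lemma maximal_term a l x : 0 < l ->
  (\prod_(i < n) ((\1_(cube a l) x / fine (wmeas (sigma i) (cube a l)))%:E *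
     \int[mu]_(y in cube a l) (Normc.normc (f i y) * sigma i y)%:E) =
   (\1_(cube a l) x * (L * \prod_(i < n)
     (fine (\int[mu]_(y in cube a l) (g i y * w i y)%:E) /
      fine (\int[mu]_(y in cube a l) (w i y)%:E))))%:E)%E.
Proof.
move=> l0; have mQ := measurable_cube a l; set Q := cube a l in mQ *.
have sw i : wmeas (sigma i) Q = (\int[mu]_(y in Q) (w i y)%:E)%E.
  exact: wmeas_ae.
have ngw i : nnmeas (fun y => g i y * w i y) by exact: nnmeasM.
have nlgw i : nnmeas (fun y => lam i * (g i y * w i y)).
  by apply: nnmeasM => //; exact/nnmeas_cst/ltW.
have fw i : (\int[mu]_(y in Q) (Normc.normc (f i y) * sigma i y)%:E =
    (lam i * fine (\int[mu]_(y in Q) (g i y * w i y)%:E))%:E)%E.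
  rewrite EFinM fineK; last first.
    by rewrite ge0_fin_numE; [exact: gw_cube|exact: nnmeas_int_ge0].
  rewrite -(nnmeas_intZ mu mQ (ngw i) (ltW (lam0 i))).
  apply: integral_eq_ae => //.
  - exact: nnmeas_EFin.
  - by move=> x' _; rewrite lee_fin (nlgw i).2.
  by apply: filterS2 (f_g i) (sigma_w i) => y -> -> _; rewrite mulrA.
under eq_bigr => i _ do rewrite sw fw -EFinM.
rewrite prodEFin; congr EFin.
case: (boolP (x \in Q)) => [xQ|xQ]; last first.
  rewrite indicE (negbTE xQ) mul0r.
  by rewrite (bigD1 (Ordinal n0))//= !mul0r.
rewrite indicE xQ mul1r /L -big_split/=; apply: eq_bigr => i _.
by rewrite div1r mulrCA [_^-1 * _]mulrC.
Qed.

Lemma maximal_le x H : (forall N, grid_sum w g q N x <= H) ->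
  (0 <= maximal sigma f x <= (L * (D * H `^ q^-1))%:E)%E.
Proof.
move=> gH.
have avg0 a l : 0 <= \prod_(i < n)
     (fine (\int[mu]_(y in cube a l) (g i y * w i y)%:E) /
      fine (\int[mu]_(y in cube a l) (w i y)%:E)).
  apply: prodr_ge0 => i _; rewrite divr_ge0// fine_ge0//.
    by apply: nnmeas_int_ge0; exact: nnmeasM.
  exact: nnmeas_int_ge0.
have gs0 N : 0 <= grid_sum w g q N x by exact: (nnmeas_grid_sum _ _ _ _).2.
have H0 : 0 <= H by exact: le_trans (gs0 0%N) (gH 0%N).
apply/andP; split.
  (* the supremum ranges over a nonempty set of nonnegative terms *)
  pose a : T := [tuple 0 | i < d].
  apply: (@le_trans _ _ (\prod_(i < n)
     ((\1_(cube a 1) x / fine (wmeas (sigma i) (cube a 1)))%:E *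
     \int[mu]_(y in cube a 1) (Normc.normc (f i y) * sigma i y)%:E))%E).
    by rewrite maximal_term// lee_fin !mulr_ge0.
  by apply: ereal_sup_ubound; exists (cube a 1) => //; exists a, 1.
apply: ge_ereal_sup => _ [_ [a [l [l0 ->]]] <-].
rewrite maximal_term// lee_fin indicE.
case: (boolP (x \in cube a l)) => [/set_mem ax|_]; last first.
  by rewrite mul0r !mulr_ge0 ?powR_ge0.
rewrite mul1r ler_wpM2l//.
have w_cube' i a' l' (_ : 0 < l') := w_cube i a' l'.
have [N hN] := cube_average_le d0 nw w_gt0 w_cube' ng gw_cube C1 w_doubling
  (ltW q0) l0 ax.
set P := \prod_(i < n) _ in hN *.
have P0 : 0 <= P by exact: avg0.
have -> : P = (P `^ q) `^ q^-1 by rewrite -powRrM divff ?gt_eqF// powRr1.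
have {1}-> : D = (D `^ q) `^ q^-1 by rewrite -powRrM divff ?gt_eqF// powRr1.
rewrite -powRM ?powR_ge0//; apply: ge0_ler_powR.
- by rewrite invr_ge0 ltW.
- by rewrite nnegrE powR_ge0.
- by rewrite nnegrE mulr_ge0 ?powR_ge0.
by rewrite (le_trans hN)// ler_wpM2l ?powR_ge0.
Qed.

Variables (Psi : R -> R) (kPsi : R).
Hypothesis kPsi0 : 0 < kPsi.
Hypothesis Psi_le : forall t, 0 <= t -> Psi t <= kPsi * t `^ q.
Variables (omega o : T -> R) (G : T -> \bar R).
Hypothesis o_gt0 : forall x, 0 < o x.
Hypothesis omega_o : {ae mu, forall x, omega x = o x}.
Hypothesis mG : measurable_fun setT G.
Hypothesis G0 : forall x, (0 <= G x)%E.
Hypothesis leG : forall N x, ((grid_sum w g q N x * o x)%:E <= G x)%E.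

Lemma maximal_modular (r : R) : 0 < r ->
  (\int[mu]_x (er_map Psi ((r^-1)%:E * maximal sigma f x) * (omega x)%:E) <=
   (kPsi * (r^-1 * (L * D)) `^ q)%:E * \int[mu]_x G x)%E.
Proof.
move=> r0; set k := kPsi * _; have r'0 : 0 < r^-1 by rewrite invr_gt0.
have L_gt0 : 0 < L by apply: prodr_gt0 => i _; exact: lam0.
have D_gt0 : 0 < D.
  by apply: prodr_gt0 => i _; rewrite exprn_gt0// (lt_trans ltr01).
have k0 : 0 < k by rewrite mulr_gt0// powR_gt0// !mulr_gt0.
rewrite -ge0_integralZl_EFin//; last exact: ltW.
apply: integral_le_ae => //.
- exact: measurable_funeM.
- by move=> x _; rewrite mule_ge0// lee_fin ltW.
apply: filterS omega_o => x -> _.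
have [->|Gx] := eqVneq (G x) +oo%E; first by rewrite gt0_muley ?lte_fin// leey.
have Gfin : G x \is a fin_num by rewrite ge0_fin_numE// ltey.
pose H := fine (G x) / o x.
have HG : H * o x = fine (G x) by rewrite divfK// gt_eqF.
have gH N : grid_sum w g q N x <= H.
  by rewrite ler_pdivlMr// -lee_fin fineK.
have H0 : 0 <= H by rewrite divr_ge0 ?fine_ge0// ltW.
have /andP[m0 mle] := maximal_le gH.
have mfin : maximal sigma f x \is a fin_num.
  by rewrite ge0_fin_numE// (le_lt_trans mle)// ltry.
rewrite -(fineK mfin) in m0 mle *; rewrite -(fineK Gfin) -HG.
move: m0 mle; rewrite !lee_fin; set m := fine (maximal _ _ _) => m0 mle.
rewrite mulrA ler_wpM2r ?(ltW (o_gt0 x))//.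
apply: (le_trans (Psi_le (mulr_ge0 (ltW r'0) m0))).
rewrite /k -mulrA ler_wpM2l ?(ltW kPsi0)//.
have -> : H = (H `^ q^-1) `^ q.
  by rewrite -powRrM mulVf ?gt_eqF// powRr1.
rewrite -powRM ?powR_ge0//; last by rewrite !mulr_ge0// ltW.
apply: ge0_ler_powR; rewrite ?nnegrE ?(ltW q0)//.
- by rewrite mulr_ge0// ltW.
- by rewrite !mulr_ge0 ?powR_ge0// ltW.
by rewrite -mulrA ler_wpM2l ?(ltW r'0)// -mulrA.
Qed.

End maximal_modular.

(** * Exponents of the growth functions, and products of infima *)

Section exponents.
Context (R : realType).
Implicit Types (Phi Psi : R -> R) (p q : R).

(** Near 0 the ratio behaves like [t `^ (q - p)], which is unbounded if q < p. *)
Lemma power_like_nd_exponent p q Phi Psi :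
  power_like p Phi -> power_like q Psi ->
  (forall s t, 0 < s -> s <= t -> Psi s / Phi s <= Psi t / Phi t) -> p <= q.
Proof.
move=> hp hq mono; have [k k0 hk] := hp; have [l l0 hl] := hq.
rewrite leNgt; apply/negP => qp; have d0 : 0 < p - q by rewrite subr_gt0.
have Phi0 t : 0 < t -> 0 < Phi t by exact: power_like_gt0 hp.
have Psi0 t : 0 < t -> 0 < Psi t by exact: power_like_gt0 hq.
pose M := k * l * (Psi 1 / Phi 1).
have M0 : 0 < M by rewrite mulr_gt0 ?divr_gt0 ?Phi0 ?Psi0 ?mulr_gt0.
(* the point where [t `^ (q - p)] exceeds the bound [M] *)
pose t := (M + 1) `^ (- (p - q)^-1).
have t0 : 0 < t by rewrite powR_gt0// addr_gt0.
have t1 : t <= 1.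
  have M1 : 1 <= M + 1 by rewrite lerDr ltW.
  have e0 : 0 <= (p - q)^-1 by rewrite invr_ge0 ltW.
  rewrite /t powRN invf_le1 ?powR_gt0 ?addr_gt0//.
  by rewrite -[leLHS](powRr0 (M + 1)); exact: ler_powR.
have tE : t `^ (q - p) = M + 1.
  rewrite -opprB /t -powRrM mulrNN mulVf ?gt_eqF// powRr1//.
  by rewrite addr_ge0// (ltW M0).
have [h1 h2] : l^-1 * t `^ q <= Psi t /\ Phi t <= k * t `^ p.
  by have /andP[? ?] := hl _ t0; have /andP[? ?] := hk _ t0.
have h3 : Psi t <= Psi 1 / Phi 1 * Phi t by rewrite -ler_pdivrMr ?Phi0// mono.
have tp0 : 0 < t `^ p by rewrite powR_gt0.
have h4 : l^-1 * t `^ q <= Psi 1 / Phi 1 * (k * t `^ p).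
  apply: (le_trans h1); apply: (le_trans h3).
  by rewrite ler_wpM2l// ltW// divr_gt0 ?Phi0 ?Psi0.
have : M + 1 <= M.
  rewrite -tE powRB ?(gt_eqF t0) ?implybT// ler_pdivrMr//.
  rewrite /M -(ler_pM2l (_ : 0 < l^-1)) ?invr_gt0//.
  apply: (le_trans h4); rewrite le_eqVlt; apply/orP; left; apply/eqP.
  by field; rewrite (gt_eqF l0) (gt_eqF (Phi0 1 ltr01)).
by rewrite gerDl ler10.
Qed.

Lemma invRplus_power_like q Phi : 0 < q -> growth_function Phi ->
  power_like q Phi -> power_like q^-1 (invRplus Phi).
Proof.
move=> q0 gf; move/(power_like_inv q0); apply => y y0; split.
  exact: invRplus_gt0.
exact: (invRplusK gf (ltW y0)).2.
Qed.

(** The product formula makes the inverse of [Phi] comparable to a power; [Phi]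
    itself is then recovered as the inverse of its inverse. *)
Lemma bijection_power_like n (Phis : 'I_n -> R -> R) (e : 'I_n -> R) Phi :
  (0 < n)%N -> set_bij Rplus Rplus Phi ->
  (forall t : R, 0 <= t -> invRplus Phi t = \prod_(i < n) invRplus (Phis i) t) ->
  (forall i, 0 < e i) -> (forall i, growth_function (Phis i)) ->
  (forall i, power_like (e i) (Phis i)) ->
  power_like (\sum_(i < n) (e i)^-1) (invRplus Phi) /\
  power_like (\sum_(i < n) (e i)^-1)^-1 Phi.
Proof.
move=> n0 [Phi0 inj surj] PhiV e0 gf pl.
have se0 : 0 < \sum_(i < n) (e i)^-1.
  rewrite (bigD1 (Ordinal n0))//= ltr_wpDr ?invr_gt0//.
  by rewrite sumr_ge0// => i _; rewrite invr_ge0 ltW.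
have plV : power_like (\sum_(i < n) (e i)^-1) (invRplus Phi).
  apply: (@eq_power_like _ _ (fun t => \prod_(i < n) invRplus (Phis i) t)).
    by move=> t t0; rewrite PhiV// ltW.
  by apply: power_like_prod => i; exact: invRplus_power_like.
split=> //; apply: (power_like_inv se0 plV) => t t0.
have tR : t \in Rplus by rewrite inE; apply/RplusP; exact: ltW.
have PhiK : invRplus Phi (Phi t) = t by exact: (pinvKV (fun=> 0) inj).
split=> //; have /RplusP : Rplus (Phi t) by apply: Phi0; exact/RplusP/ltW.
rewrite le_eqVlt => /predU1P[Pt0|//].
move: t0; rewrite -PhiK -Pt0 PhiV// (bigD1 (Ordinal n0))//=.
suff -> : invRplus (Phis (Ordinal n0)) 0 = 0 by rewrite mul0r ltxx.
have [x0 Px] := invRplusK (gf (Ordinal n0)) (lexx 0).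
move: x0; rewrite le_eqVlt => /predU1P[//|x0].
by have := power_like_gt0 (pl (Ordinal n0)) x0; rewrite Px ltxx.
Qed.

End exponents.

Section infima.
Context (R : realType).

(** A quantitative form of the continuity at 0 of a product of translates. *)
Lemma prod_addr_le n (a : 'I_n -> R) : (forall i, 0 <= a i) ->
  exists2 M, 0 <= M & forall x, 0 <= x -> x <= 1 ->
    \prod_(i < n) (a i + x) <= \prod_(i < n) a i + x * M.
Proof.
elim: n a => [|n IH] a a0.
  by exists 0 => // x _ _; rewrite !big_ord0 mulr0 addr0.
have [M M0 hM] := IH (fun i => a (lift ord0 i)) (fun i => a0 _).
set P := \prod_(i < n) a (lift ord0 i) in hM *.
have P0 : 0 <= P by exact: prodr_ge0.
exists (P + a ord0 * M + M); first by rewrite !addr_ge0// mulr_ge0.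
move=> x x0 x1; rewrite !big_ord_recl -/P.
apply: (@le_trans _ _ ((a ord0 + x) * (P + x * M))).
  by rewrite ler_wpM2l ?hM// addr_ge0.
have : x * (x * M) <= x * M by rewrite ler_wpM2l// ler_piMl.
by lra.
Qed.

(** Infima of sets of positive reals can be taken factor by factor; this passes
    from admissible Luxemburg radii to the Luxemburg norms. *)
Lemma le_prod_ereal_inf n (S : 'I_n -> set R) (K : R) (X : \bar R) :
  0 <= K -> (forall i l, S i l -> 0 < l) ->
  (forall i, ereal_inf [set l%:E | l in S i] < +oo)%E ->
  (forall l : 'I_n -> R, (forall i, S i (l i)) ->
    (X <= (K * \prod_(i < n) l i)%:E)%E) ->
  (X <= K%:E * \prod_(i < n) ereal_inf [set l%:E | l in S i])%E.
Proof.
move=> K0 S0 Soo hX.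
have inf0 i : (0 <= ereal_inf [set l%:E | l in S i])%E.
  by apply: le_ereal_inf_tmp => _ [l Sl <-]; rewrite lee_fin ltW// (S0 i).
have inff i : ereal_inf [set l%:E | l in S i] \is a fin_num.
  by rewrite ge0_fin_numE.
pose a i := fine (ereal_inf [set l%:E | l in S i]).
have aE i : ereal_inf [set l%:E | l in S i] = (a i)%:E by rewrite fineK.
have a0 i : 0 <= a i by exact: fine_ge0.
under eq_bigr do rewrite aE.
rewrite prodEFin -EFinM.
have [M M0 hM] := prod_addr_le a0.
have hx x : 0 < x -> (X <= (K * \prod_(i < n) (a i + x))%:E)%E.
  move=> x0.
  have /choice[l hl] : forall i, exists l, S i l /\ l < a i + x.
    move=> i; have [_ [l Sl <-]] := lb_ereal_inf_adherent x0 (inff i).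
    by rewrite aE -EFinD lte_fin => lx; exists l.
  apply: (le_trans (hX l (fun i => (hl i).1))).
  rewrite lee_fin ler_wpM2l// ler_prod// => i _.
  by rewrite (ltW (S0 _ _ (hl i).1)) (ltW (hl i).2).
apply/lee_addgt0Pr => eps eps0.
pose x := Num.min 1 (eps / (K * M + 1)).
have KM0 : 0 < K * M + 1 by rewrite ltr_wpDl// mulr_ge0.
have x0 : 0 < x by rewrite lt_min ltr01 divr_gt0.
have x1 : x <= 1 by rewrite ge_min lexx.
have x2 : x * (K * M + 1) <= eps by rewrite -ler_pdivlMr// ge_min lexx orbT.
apply: (le_trans (hx x x0)); rewrite -EFinD lee_fin.
apply: (le_trans (ler_wpM2l K0 (hM x (ltW x0) x1))).
by rewrite mulrDr lerD2l (le_trans _ x2)// mulrCA ler_pM2l// lerDl.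
Qed.

End infima.

(** * The testing condition in terms of the geometric weight *)

Section testing_condition.
Context (R : realType) (d n : nat).
Local Notation T := (d.-tuple R).
Local Notation mu := (lebesgue_tuple R d).
Variables (Phis : 'I_n -> R -> R) (e : 'I_n -> R) (Phi : R -> R) (p : R).
Hypothesis e0 : forall i, 0 < e i.
Hypothesis p0 : 0 < p.
Hypothesis gf : forall i, growth_function (Phis i).
Hypothesis pl : forall i, power_like (e i) (Phis i).
Hypothesis plPhi : power_like p Phi.

Lemma nu_value_comparable : exists2 k, 0 < k & forall s : 'I_n -> R,
  (forall i, 0 < s i) ->
  k^-1 * \prod_(i < n) s i `^ (p / e i) <=
    (Phi (\prod_(i < n) invRplus (Phis i) (s i)^-1))^-1 <=
  k * \prod_(i < n) s i `^ (p / e i).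
Proof.
have /choice[ki hki] : forall i, exists k, 0 < k /\ forall t, 0 < t ->
    k^-1 * t `^ (e i)^-1 <= invRplus (Phis i) t <= k * t `^ (e i)^-1.
  move=> i; have [k k0 hk] := invRplus_power_like (e0 i) (gf i) (pl i).
  by exists k.
have [kp kp0 hkp] := plPhi.
pose K := \prod_(i < n) ki i.
have K0 : 0 < K by apply: prodr_gt0 => i _; exact: (hki i).1.
have Kp0 : 0 < kp * K `^ p by rewrite mulr_gt0 ?powR_gt0.
exists (kp * K `^ p) => // s s0.
have si0 i : 0 < (s i)^-1 by rewrite invr_gt0.
set X := \prod_(i < n) invRplus (Phis i) _.
pose Y := \prod_(i < n) (s i)^-1 `^ (e i)^-1.
have Y0 : 0 < Y by apply: prodr_gt0 => i _; exact: powR_gt0.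
have X0 : 0 < X by apply: prodr_gt0 => i _; exact: invRplus_gt0.
have XY : X <= K * Y.
  rewrite /K /Y -big_split/=; apply: ler_prod => i _.
  by rewrite ltW ?invRplus_gt0//=; have /andP[] := (hki i).2 _ (si0 i).
have YX : Y <= K * X.
  rewrite /K /X -big_split/=; apply: ler_prod => i _.
  rewrite powR_ge0/=; have /andP[h _] := (hki i).2 _ (si0 i).
  by rewrite -ler_pdivrMl// (hki i).1.
set gw := \prod_(i < n) _.
have gw0 : 0 < gw by apply: prodr_gt0 => i _; exact: powR_gt0.
have Yp : Y `^ p = gw^-1.
  rewrite /Y powR_prod; last by move=> i; exact: powR_ge0.
  rewrite /gw -prodfV; apply: eq_bigr => i _.
  by rewrite -powRrM mulrC powR_invr.
have XYp : X `^ p <= K `^ p * gw^-1.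
  rewrite -Yp -powRM ?(ltW K0) ?(ltW Y0)//; apply: ge0_ler_powR; rewrite ?nnegrE//.
  - exact: ltW.
  - exact: ltW.
  - by rewrite mulr_ge0 ?ltW.
have YXp : gw^-1 <= K `^ p * X `^ p.
  rewrite -Yp -powRM ?(ltW K0) ?(ltW X0)//; apply: ge0_ler_powR; rewrite ?nnegrE//.
  - exact: ltW.
  - exact: ltW.
  - by rewrite mulr_ge0 ?ltW.
have /andP[h1 h2] := hkp _ X0.
have PX0 : 0 < Phi X by exact: power_like_gt0 plPhi X0.
apply/andP; split.
  rewrite -[_ * gw]invrK lef_pV2 ?posrE ?invr_gt0 ?mulr_gt0 ?invr_gt0//.
  rewrite invfM invrK (le_trans h2)// -mulrA ler_wpM2l//.
  exact: ltW.
rewrite -[kp * _ * gw]invrK lef_pV2 ?posrE ?invr_gt0 ?mulr_gt0 ?powR_gt0//.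
rewrite invfM (le_trans _ h1)// invfM -mulrA ler_wpM2l ?invr_ge0 ?(ltW kp0)//.
by rewrite ler_pdivrMl ?powR_gt0.
Qed.

Variables (sigma w : 'I_n -> T -> R).
Hypothesis nw : forall i, nnmeas (w i).
Hypothesis w_gt0 : forall i x, 0 < w i x.
Hypothesis w_cube : forall i a l,
  (\int[mu]_(y in cube a l) (w i y)%:E < +oo)%E.
Hypothesis sigma_w : forall i, {ae mu, forall x, sigma i x = w i x}.
Hypothesis pe : \sum_(i < n) p / e i = 1.

Local Notation gw := (geometric_weight w e p).

Lemma int_geometric_weight a l : 0 < l ->
  (0 < \int[mu]_(y in cube a l) (gw y)%:E < +oo)%E.
Proof.
move=> l0; have nV : nnmeas gw by exact: nnmeas_geometric_weight.
have mQ := measurable_cube a l.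
apply/andP; split.
  apply: integral_gt0 => //; first exact: nnmeas_EFin.
  - by move=> x _; rewrite lte_fin; apply: prodr_gt0 => i _; exact: powR_gt0.
  - have muQ : (0 < mu (cube a l))%E by rewrite mu_cube// lte_fin exprn_gt0.
    exact: muQ.
apply: (@le_lt_trans _ _
  (\int[mu]_(y in cube a l) (\sum_(i < n) w i y)%:E)%E).
  apply: nnmeas_int_le => //; first exact: nnmeas_sum.
  move=> x _; apply: prod_powR_le_sum => // i; [exact: (nw i).2|].
  exact: divr_gt0.
by rewrite (nnmeas_int_sum mu _ mQ nw); apply: lte_sum_pinfty => i _.
Qed.

(** Positivity and finiteness of the nu-measure of a cube are what makes the
    inverse in the testing quantity meaningful. *)
Lemma wmeas_nu_comparable : exists2 k, 0 < k & forall a l, 0 < l ->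
  0 < fine (wmeas (nu sigma Phis Phi) (cube a l)) <=
    k * fine (\int[mu]_(y in cube a l) (gw y)%:E).
Proof.
have [k k0 hk] := nu_value_comparable; exists k => // a l l0.
have nV : nnmeas gw by exact: nnmeas_geometric_weight.
have mQ := measurable_cube a l.
have /andP[V0 Voo] := int_geometric_weight a l0.
have Vfin : (\int[mu]_(y in cube a l) (gw y)%:E)%E \is a fin_num.
  by rewrite ge0_fin_numE// ltW.
have aeE : {ae mu, forall x, k^-1 * gw x <= nu sigma Phis Phi x <= k * gw x}.
  have : {ae mu, forall x, forall i, sigma i x = w i x}.
    exact: filter_forall.
  apply: filterS => x sw; have := hk (fun i => w i x) (fun i => w_gt0 i x).
  rewrite /nu; have -> // : \prod_(i < n) invRplus (Phis i) (sigma i x)^-1 =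
      \prod_(i < n) invRplus (Phis i) (w i x)^-1.
  by apply: eq_bigr => i _; rewrite sw.
have ki0 : 0 <= k^-1 by rewrite invr_ge0 ltW.
have up : (wmeas (nu sigma Phis Phi) (cube a l) <=
    k%:E * \int[mu]_(y in cube a l) (gw y)%:E)%E.
  have nkV : nnmeas (fun y => k * gw y).
    by apply: nnmeasM => //; exact/nnmeas_cst/ltW.
  rewrite -(nnmeas_intZ mu mQ nV (ltW k0)); apply: integral_le_ae => //.
  - exact: nnmeas_EFin.
  - by move=> x _; rewrite lee_fin nkV.2.
  by apply: filterS aeE => x /andP[_ h] _; rewrite lee_fin.
have lo : ((k^-1)%:E * \int[mu]_(y in cube a l) (gw y)%:E <=
    wmeas (nu sigma Phis Phi) (cube a l))%E.
  have nkV : nnmeas (fun y => k^-1 * gw y).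
    by apply: nnmeasM => //; exact/nnmeas_cst.
  rewrite -(nnmeas_intZ mu mQ nV ki0); apply: le_integral_ae => //.
  - exact: nnmeas_EFin.
  - by move=> x _; rewrite lee_fin nkV.2.
  by apply: filterS aeE => x /andP[h _] _; rewrite lee_fin.
have nu0 : (0 < wmeas (nu sigma Phis Phi) (cube a l))%E.
  by apply: lt_le_trans lo; rewrite mule_gt0// lte_fin invr_gt0.
have nuoo : (wmeas (nu sigma Phis Phi) (cube a l) < +oo)%E.
  by apply: le_lt_trans up _; rewrite -(fineK Vfin) -EFinM ltry.
apply/andP; split; first by apply: fine_gt0; rewrite nu0 nuoo.
rewrite -lee_fin EFinM (fineK Vfin) fineK//.
by rewrite ge0_fin_numE// ltW.
Qed.

Variables (Psi : R -> R) (s : R).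
Hypothesis s0 : 0 <= s.
Hypothesis plchi : power_like s (Psi \o invRplus Phi).

(** The testing quantity of a single cube is at most the testing constant, and
    [Psi \o invRplus Phi] is comparable to a power. Positivity of the testing
    constant is part of the conclusion because the Luxemburg radius of the
    maximal function will be a power of it. *)
Lemma testing_geometric_weight : exists2 k, 0 < k &
  forall omega o : T -> R, nnmeas o -> (forall x, 0 < o x) ->
    (forall a l, (\int[mu]_(y in cube a l) (o y)%:E < +oo)%E) ->
    {ae mu, forall x, omega x = o x} ->
    (testing sigma omega Phis Phi Psi < +oo)%E ->
    0 < fine (testing sigma omega Phis Phi Psi) /\
    forall a l, 0 < l -> (\int[mu]_(y in cube a l) (o y)%:E <=
      (fine (testing sigma omega Phis Phi Psi) * k *
       fine (\int[mu]_(y in cube a l) (gw y)%:E) `^ s)%:E)%E.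
Proof.
have [k k0 hk] := wmeas_nu_comparable; have [c c0 hc] := plchi.
exists (c * k `^ s) => [|omega o no o0 ooo oo Aoo].
  by rewrite mulr_gt0// powR_gt0.
set A := testing _ _ _ _ _ in Aoo *.
pose chi t := Psi (invRplus Phi t).
have chi0 t : 0 < t -> 0 < chi t by exact: power_like_gt0 plchi.
pose N a l := fine (wmeas (nu sigma Phis Phi) (cube a l)).
pose V a l := fine (\int[mu]_(y in cube a l) (gw y)%:E).
have omE a l : wmeas omega (cube a l) = (\int[mu]_(y in cube a l) (o y)%:E)%E.
  by apply: wmeas_ae => //; exact: measurable_cube.
have Iofin a l : (\int[mu]_(y in cube a l) (o y)%:E)%E \is a fin_num.
  by rewrite ge0_fin_numE//; exact: nnmeas_int_ge0.
have term a l : 0 < l ->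
    (\int[mu]_(y in cube a l) (o y)%:E * (chi (N a l)^-1)%:E <= A)%E.
  move=> l0; apply: ereal_sup_ubound; exists (cube a l); first by exists a, l.
  by rewrite omE.
have N0 a l : 0 < l -> 0 < N a l by move=> l0; have /andP[] := hk a l l0.
have Io0 a l : 0 < l -> (0 < \int[mu]_(y in cube a l) (o y)%:E)%E.
  move=> l0; apply: integral_gt0; first exact: measurable_cube.
  - exact: nnmeas_EFin.
  - by move=> x _; rewrite lte_fin.
  - have muQ : (0 < mu (cube a l))%E by rewrite mu_cube// lte_fin exprn_gt0.
    exact: muQ.
have A0 : (0 < A)%E.
  pose a : T := [tuple 0 | i < d].
  apply: lt_le_trans (term a 1 ltr01); rewrite mule_gt0 ?Io0// lte_fin.
  by rewrite chi0// invr_gt0 N0.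
have Afin : A \is a fin_num by rewrite ge0_fin_numE// ltW.
split; first by rewrite fine_gt0// A0.
move=> a l l0; have := term a l l0.
rewrite -(fineK Afin) -(fineK (Iofin a l)) -EFinM !lee_fin.
set I := fine (\int[mu]_(y in cube a l) (o y)%:E)%E; set B := fine A => IB.
have B0 : 0 < B by rewrite fine_gt0// A0.
have /andP[Np NV] := hk a l l0; rewrite -/(N a l) -/(V a l) in Np NV.
have Vp : 0 < V a l.
  by move: (lt_le_trans Np NV); rewrite pmulr_rgt0.
have Ni : 0 < (N a l)^-1 by rewrite invr_gt0.
have /andP[h _] := hc _ Ni; rewrite /= -/(chi _) powR_invr// in h.
have Ns : N a l `^ s <= k `^ s * V a l `^ s.
  rewrite -powRM ?(ltW k0) ?(ltW Vp)//; apply: ge0_ler_powR => //;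
    by rewrite nnegrE ltW// mulr_gt0.
have Np' : 0 < N a l `^ s by rewrite powR_gt0.
have h2 : I * (c^-1 * (N a l `^ s)^-1) <= B.
  apply: le_trans IB; rewrite ler_wpM2l// fine_ge0//.
  exact: nnmeas_int_ge0.
have cN0 : 0 < c * N a l `^ s by exact: mulr_gt0.
rewrite -invfM ler_pdivrMr// in h2; apply: (le_trans h2); rewrite -!mulrA.
apply: ler_wpM2l; first exact: ltW.
by apply: ler_wpM2l; first exact: ltW.
Qed.

End testing_condition.

(** * The two weight bound *)

Section modular.
Context (R : realType) (d : nat).
Local Notation T := (d.-tuple R).
Local Notation mu := (lebesgue_tuple R d).

(** An admissible Luxemburg radius for [Phi] normalises the L^e norm, by the lower
    comparison of [Phi] with [t `^ e]. *)
Lemma modular_power (Phi : R -> R) (e k lam : R) (sigma w h : T -> R)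
    (f : T -> R[i]) : growth_function Phi -> 0 < e -> 0 < k ->
  (forall t, 0 < t -> k^-1 * t `^ e <= Phi t) ->
  nnmeas w -> {ae mu, forall x, sigma x = w x} ->
  nnmeas h -> {ae mu, forall x, Normc.normc (f x) = h x} -> 0 < lam ->
  (\int[mu]_x (er_map Phi ((lam^-1)%:E * cnorm f x) * (sigma x)%:E) <= 1)%E ->
  (\int[mu]_x ((lam^-1 * h x) `^ e * w x)%:E <= k%:E)%E.
Proof.
move=> gf e0 k0 hk nw sw nh fh lam0 le1.
have lami0 : 0 < lam^-1 by rewrite invr_gt0.
have nf : nnmeas (fun x => (lam^-1 * h x) `^ e * w x).
  apply: nnmeasM => //; apply: nnmeas_powR; apply: nnmeasM => //.
  exact/nnmeas_cst/ltW.
have ki0 : 0 <= k^-1 by rewrite invr_ge0 ltW.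
have nkf : nnmeas (fun x => k^-1 * ((lam^-1 * h x) `^ e * w x)).
  by apply: nnmeasM => //; exact: nnmeas_cst.
have kE : k%:E = (k%:E * 1)%E by rewrite mule1.
have h2 : ((k^-1)%:E * \int[mu]_x ((lam^-1 * h x) `^ e * w x)%:E <= 1)%E.
  rewrite -(nnmeas_intZ mu measurableT nf ki0); apply: le_trans le1.
  apply: le_integral_ae => //.
  - exact: nnmeas_EFin.
  - by move=> x _; rewrite lee_fin nkf.2.
  apply: filterS2 sw fh => x -> fx _.
  rewrite /cnorm fx lee_fin mulrA ler_wpM2r ?nw.2//.
  have := mulr_ge0 (ltW lami0) (nh.2 x); rewrite le_eqVlt => /predU1P[<-|/hk//].
  by rewrite powR0 ?gt_eqF// mulr0 growth_function0.
apply: (@le_trans _ _ (k%:E * ((k^-1)%:E *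
    \int[mu]_x ((lam^-1 * h x) `^ e * w x)%:E))%E).
  by rewrite muleA -EFinM divff ?gt_eqF// mul1e.
by rewrite [leRHS]kE; apply: lee_wpmul2l => //; rewrite lee_fin ltW.
Qed.

Lemma lux_norm_le (Psi : R -> R) (omega : T -> R) (g : T -> \bar R) (r : R) :
  0 < r ->
  (\int[mu]_x (er_map Psi ((r^-1)%:E * g x) * (omega x)%:E) <= 1)%E ->
  (lux_norm Psi omega g <= r%:E)%E.
Proof. by move=> r0 hr; apply: ereal_inf_lbound; exists r. Qed.

End modular.

Theorem theorem3p4 (R : realType) (d n : nat) (hd : (0 < d)%N) (hn : (0 < n)%N)
    (sigma : 'I_n -> d.-tuple R -> R) (Phis : 'I_n -> R -> R) (Psi Phi : R -> R)
    (hsigma : forall i, weight (sigma i))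
    (hPhis : forall i, classUtilde (Phis i) /\ nabla2 (Phis i))
    (hPsi : classUtilde Psi)
    (hPhi : set_bij Rplus Rplus Phi)
    (hPhiV : forall t : R, 0 <= t ->
       invRplus Phi t = \prod_(i < n) invRplus (Phis i) t)
    (hPsiPhi : forall s t : R, 0 < s -> s <= t -> Psi s / Phi s <= Psi t / Phi t)
    (hdoubling : forall i, doubling (sigma i)) :
  exists2 C : R, 0 < C &
    forall omega : d.-tuple R -> R, weight omega ->
      (testing sigma omega Phis Phi Psi < +oo)%E ->
      forall f : 'I_n -> d.-tuple R -> R[i],
        (forall i, orlicz (Phis i) (sigma i) (f i)) ->
        (lux_norm Psi omega (maximal sigma f) <=
         (C * invRplus Psi (fine (testing sigma omega Phis Phi Psi)))%:E *
         \prod_(i < n) lux_norm (Phis i) (sigma i) (cnorm (f i)))%E.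
Proof.
have /choice[e he] : forall i, exists e, [/\ 1 < e, growth_function (Phis i) &
    power_like e (Phis i)].
  move=> i; have [[e e1 ce] n2] := hPhis i; exists e; split.
  - exact: classUtilde_nabla2_exponent ce n2.
  - by case: ce => -[].
  - by apply: classUtilde_power_like => //; exact: lt_le_trans e1.
have e1 i : 1 < e i by have [] := he i.
have e0 i : 0 < e i by exact: lt_trans ltr01 (e1 i).
have gf i : growth_function (Phis i) by have [] := he i.
have pl i : power_like (e i) (Phis i) by have [] := he i.
have /choice[k hk] : forall i, exists k, 0 < k /\
    forall t, 0 < t -> k^-1 * t `^ e i <= Phis i t.
  move=> i; have [k k0 hk] := pl i; exists k; split=> // t t0.
  by have /andP[] := hk t t0.
have [q q1 cq] := hPsi.
have q0 : 0 < q by exact: lt_le_trans q1.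
have gPsi : growth_function Psi by case: cq => -[].
have plPsi : power_like q Psi by exact: classUtilde_power_like.
have [plV plPhi] := bijection_power_like hn hPhi hPhiV e0 gf pl.
set s0 := \sum_(i < n) (e i)^-1 in plV plPhi.
have s0_gt0 : 0 < s0.
  rewrite /s0 (bigD1 (Ordinal hn))//= ltr_wpDr ?invr_gt0//.
  by rewrite sumr_ge0// => i _; rewrite invr_ge0 ltW.
pose p := s0^-1; have p0 : 0 < p by rewrite invr_gt0.
have pe : \sum_(i < n) p / e i = 1 by rewrite -mulr_sumr mulVf// gt_eqF.
have pq : p <= q by exact: power_like_nd_exponent plPhi plPsi hPsiPhi.
have plchi : power_like (q / p) (Psi \o invRplus Phi).
  by rewrite /p invrK mulrC; exact: power_like_comp (ltW q0) plPsi plV.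
have s_ge0 : 0 <= q / p by rewrite divr_ge0 ?ltW.
have /choice[w hw] := fun i => weight_regular (hsigma i).
have nw i : nnmeas (w i) by have [] := hw i.
have w_gt0 i x : 0 < w i x by have [] := hw i.
have sw i : {ae lebesgue_tuple R d, forall x, sigma i x = w i x}.
  by have [] := hw i.
have w_cube i a l : (\int[lebesgue_tuple R d]_(y in cube a l) (w i y)%:E < +oo)%E.
  by have [] := hw i.
have /choice[C hC] : forall i, exists C, 1 < C /\
    forall a l a' l', 0 < l -> 0 < l' -> cube a l `<=` cube a' l' ->
      l' <= 2 * l ->
      (wmeas (w i) (cube a' l') <= C%:E * wmeas (w i) (cube a l))%E.
  move=> i; have [C C1 hC] := hdoubling i; exists C; split=> // a l a' l' *.
  have wE b r : wmeas (w i) (cube b r) = wmeas (sigma i) (cube b r).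
    exact/esym/(wmeas_ae (measurable_cube _ _) (nw i) (sw i)).
  by rewrite !wE; exact: hC.
have C1 i := (hC i).1; have w_doubling i := (hC i).2.
have [kt kt0 testing_o] := testing_geometric_weight e0 p0 gf pl plPhi nw w_gt0
  w_cube sw pe s_ge0 plchi.
have [kI kI0 hkI] := invRplus_power_like q0 gPsi plPsi.
have [kP kP0 hkP] := plPsi.
have Psi_le t : 0 <= t -> Psi t <= kP * t `^ q.
  rewrite le_eqVlt => /predU1P[<-|/hkP/andP[]//].
  by rewrite growth_function0// powR0 ?mulr0// gt_eqF.
pose D := \prod_(i < n) C i ^+ 4.
have D0 : 0 < D.
  by apply: prodr_gt0 => i _; rewrite exprn_gt0// (lt_trans ltr01).
pose N := strong_const e k `^ (q / p); have N0 : 0 <= N by exact: powR_ge0.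
pose m : R := #|{ffun 'I_d -> 'I_3}|%:R.
have m0 : 0 < m.
  by rewrite ltr0n; apply/card_gt0P; exists [ffun=> ord0].
(* [N + 1] instead of [N] only ensures that [Z] is positive. *)
pose Z := kP * m * kt * (N + 1).
have Z0 : 0 < Z by rewrite !mulr_gt0// ltr_wpDl.
exists (D * Z `^ q^-1 * kI); first by rewrite !mulr_gt0// powR_gt0.
move=> omega womega Aoo f hf.
have [v [nv v_gt0 om_v v_cube]] := weight_regular womega.
have [A0 test] := testing_o omega v nv v_gt0 v_cube om_v Aoo.
set A := fine _ in A0 test *.
have VA0 : 0 < invRplus Psi A by exact: invRplus_gt0.
have Cst0 : 0 <= D * Z `^ q^-1 * kI * invRplus Psi A.
  by rewrite ltW// !mulr_gt0// powR_gt0.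
rewrite /lux_norm -/(lux_norm Psi omega (maximal sigma f)).
apply: le_prod_ereal_inf => //.
- by move=> i l [].
- by move=> i; have [_ ] := hf i.
move=> lam hlam; have lam0 i : 0 < lam i := (hlam i).1.
have /choice[h hh] : forall i, exists h, nnmeas h /\
    {ae lebesgue_tuple R d, forall x, Normc.normc (f i x) = h x}.
  move=> i; have [h nh fh] := complex_measurable_normc (hf i).1.
  by exists h.
pose g i x := (lam i)^-1 * h i x.
have ng i : nnmeas (g i).
  apply: nnmeasM; last exact: (hh i).1.
  by apply: nnmeas_cst; rewrite invr_ge0 ltW.
have fg i : {ae lebesgue_tuple R d, forall x, Normc.normc (f i x) = lam i * g i x}.
  by apply: filterS (hh i).2 => x ->; rewrite /g mulVKf// gt_eqF.
have gB i : (\int[lebesgue_tuple R d]_x (g i x `^ e i * w i x)%:E <= (k i)%:E)%E.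
  exact: (modular_power (gf i) (e0 i) (hk i).1 (hk i).2 (nw i) (sw i)
    (hh i).1 (hh i).2 (lam0 i) (hlam i).2).
have gw_cube i a l : 0 < l ->
    (\int[lebesgue_tuple R d]_(y in cube a l) (g i y * w i y)%:E < +oo)%E.
  move=> l0; apply: (int_lty_powR (p := e i)) => //.
  - exact: measurable_cube.
  - exact: ltW.
  - exact: le_lt_trans (gB i) (ltry _).
have w_cube' i a l (_ : 0 < l) := w_cube i a l.
have [G [mG G0 leG intG]] := grid_majorant nw w_gt0 w_cube' ng e1 p0 pe pq gB nv
  (mulr_ge0 (ltW A0) (ltW kt0)) test.
pose L := \prod_(i < n) lam i.
have L0 : 0 < L by exact: prodr_gt0.
(* the radius for which the modular bound below is at most 1 *)
pose r := L * D * (Z * A) `^ q^-1.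
have ZA0 : 0 < Z * A by exact: mulr_gt0.
have r0 : 0 < r by rewrite !mulr_gt0// powR_gt0.
apply: (@le_trans _ _ r%:E).
  apply: lux_norm_le => //.
  apply: (le_trans (maximal_modular hd hn nw w_gt0 w_cube sw C1 w_doubling ng
    lam0 fg gw_cube q0 kP0 Psi_le v_gt0 om_v mG G0 leG r0)).
  have -> : (r^-1 * (L * D)) `^ q = (Z * A)^-1.
    rewrite /r invfM mulrAC mulVf ?mul1r ?gt_eqF ?mulr_gt0//.
    rewrite powR_invr ?powR_gt0// -powRrM mulVf ?gt_eqF// powRr1//.
    exact: ltW.
  apply: (@le_trans _ _ ((kP * (Z * A)^-1)%:E *
    (A * kt * N *+ #|{ffun 'I_d -> 'I_3}|)%:E)%E).
    apply: lee_wpmul2l => //.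
    by rewrite lee_fin mulr_ge0 ?invr_ge0 ?ltW.
  rewrite -EFinM lee_fin -mulr_natr -/m mulrAC ler_pdivrMr// mul1r.
  have -> : kP * (A * kt * N * m) = kP * m * kt * N * A by ring.
  by rewrite ler_wpM2r ?(ltW A0)// ler_wpM2l ?lerDl// !mulr_ge0 ?ltW.
rewrite lee_fin /r powRM ?(ltW Z0) ?(ltW A0)//.
have /andP[hA _] := hkI A A0.
have {}hA : A `^ q^-1 <= kI * invRplus Psi A by rewrite -ler_pdivrMl.
have -> : D * Z `^ q^-1 * kI * invRplus Psi A * \prod_(i < n) lam i =
    L * D * (Z `^ q^-1 * (kI * invRplus Psi A)) by rewrite /L; ring.
by rewrite ler_wpM2l ?(ltW (mulr_gt0 L0 D0))// ler_wpM2l ?powR_ge0.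
Qed.
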